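(* Let $\lambda_1\le\lambda_2\le\lambda_3\le\cdots$ be the length spectrum of the triangle group $\Gamma(2,10,10)$, listed in nondecreasing order with multiplicity. Then $$\lambda_1=\lambda_2=2\,\mathrm{arccosh}\Big(2\cos^2\tfrac{\pi}{10}\Big)\;<\;\lambda_3=2\,\mathrm{arccosh}\Big(\cos\tfrac{\pi}{10}\big(4\cos^2\tfrac{\pi}{10}-1\big)\Big).$$
   Context: Let $\mathbf H$ be the hyperbolic plane with its distance $d$. Let $T$ be a hyperbolic triangle with angles $\pi/2,\pi/10,\pi/10$; the triangle group $\Gamma(2,10,10)$ is the group of orientation-preserving elements of the group generated by the reflections in the sides of $T$. For a hyperbolic element $\gamma$ its length is $l(\gamma)=\inf\{d(x,\gamma x): x\in\mathbf H\}$. The length spectrum is the family of the numbers $l(\gamma)$ as $\gamma$ runs over the $\Gamma(2,10,10)$-conjugacy classes of hyperbolic elements of $\Gamma(2,10,10)$, each conjugacy class contributing one entry. *)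

(* Defs.v *)
From mathcomp Require Import all_boot all_order all_algebra.
From mathcomp Require Import all_classical all_reals all_analysis.

Set Implicit Arguments.
Unset Strict Implicit.
Unset Printing Implicit Defensive.

Import Order.TTheory GRing.Theory Num.Theory.
Local Open Scope classical_set_scope.
Local Open Scope ring_scope.

(** The hyperboloid model: the hyperbolic plane is the upper sheet of
    [<x, x> = -1] for the form [<x, y> = - x0 y0 + x1 y1 + x2 y2] on R^3.
    Its isometries are the restrictions of unique linear maps, so isometries
    are represented by 3 x 3 matrices acting on column vectors. *)

Definition arccosh (R : realType) (t : R) : R := ln (t + Num.sqrt (t ^+ 2 - 1)).

Definition lorentz_mx (R : realType) : 'M[R]_3 :=
  diag_mx (\row_(j < 3) (if j == 0 then -1 else 1)).

Definition lorentz (R : realType) (x y : 'cV[R]_3) : R :=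
  (x^T *m lorentz_mx R *m y) 0 0.

Definition hplane (R : realType) : set 'cV[R]_3 :=
  [set x | lorentz x x = -1 /\ 0 < x 0 0].

Definition hdist (R : realType) (x y : 'cV[R]_3) : R :=
  arccosh (- lorentz x y).

(** Every geodesic line is [hline n] for some [n] with [<n, n> = 1], and
    conversely; such an [n] is determined by the line up to sign. *)
Definition hline (R : realType) (n : 'cV[R]_3) : set 'cV[R]_3 :=
  [set x | hplane x /\ lorentz x n = 0].

(** The map [x |-> x - 2 <n, x> n]; for [<n, n> = 1] it is the reflection in
    [hline n]. *)
Definition hrefl (R : realType) (n : 'cV[R]_3) : 'M[R]_3 :=
  1 - 2 *: (n *m n^T *m lorentz_mx R).

(** The orthogonal projection of [y] to the tangent space [x^\perp] of the
    hyperboloid at [x]: a positive multiple of the initial velocity of the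
    geodesic from [x] to [y] (when [x <> y]). *)
Definition hdirection (R : realType) (x y : 'cV[R]_3) : 'cV[R]_3 :=
  y + lorentz x y *: x.

(** The angle at [x] between the geodesic segments [xy] and [xz]; the form is
    positive definite on tangent spaces. *)
Definition hangle (R : realType) (x y z : 'cV[R]_3) : R :=
  let u := hdirection x y in
  let v := hdirection x z in
  acos (lorentz u v / (Num.sqrt (lorentz u u) * Num.sqrt (lorentz v v))).

Definition htriangle (R : realType) (A B C : 'cV[R]_3) : Prop :=
  [/\ hplane A, hplane B, hplane C &
      ~ exists n, [/\ lorentz n n = 1, hline n A, hline n B & hline n C]].

Definition side_reflections (R : realType) (A B C : 'cV[R]_3) : set 'M[R]_3 :=
  [set hrefl n | n in
    [set n | lorentz n n = 1 /\
             [\/ hline n A /\ hline n B, hline n B /\ hline n C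
               | hline n C /\ hline n A]]].

Inductive generated (U : unitRingType) (S : set U) : set U :=
| generated_in g : S g -> generated S g
| generated_1 : generated S 1
| generated_M g h : generated S g -> generated S h -> generated S (g * h)
| generated_V g : generated S g -> generated S g^-1.

(** An isometry of the hyperboloid preserves the upper sheet, hence it
    preserves orientation if and only if its determinant is positive. *)
Definition triangle_group (R : realType) (A B C : 'cV[R]_3) : set 'M[R]_3 :=
  [set g | generated (side_reflections A B C) g /\ 0 < \det g].

(** Points of the circle at infinity are the rays spanned by the nonzero
    vectors of the upper light cone; the representative on a ray is normalised
    by [x0 = 1]. *)
Definition ideal_points (R : realType) : set 'cV[R]_3 :=
  [set x | lorentz x x = 0 /\ x 0 0 = 1].

Definition fixes_ideal (R : realType) (g : 'M[R]_3) (x : 'cV[R]_3) : Prop :=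
  exists a : R, g *m x = a *: x.

(** Among orientation-preserving isometries, the hyperbolic ones are those
    with exactly two fixed points at infinity. *)
Definition hyperbolic (R : realType) (g : 'M[R]_3) : Prop :=
  exists x y : 'cV[R]_3,
    x <> y /\ [set z | ideal_points z /\ fixes_ideal g z] = [set x; y].

Definition hlength (R : realType) (g : 'M[R]_3) : R :=
  inf [set hdist x (g *m x) | x in @hplane R].

Definition conj_class (U : unitRingType) (G : set U) (g : U) : set U :=
  [set h * g * h^-1 | h in G].

Definition hyperbolic_classes (R : realType) (G : set 'M[R]_3) :
    set (set 'M[R]_3) :=
  [set conj_class G g | g in [set g | G g /\ hyperbolic g]].

(** [lam 1 <= lam 2 <= lam 3 <= ...] lists the lengths of the conjugacy classes of
    hyperbolic elements of [G], each class [c k] contributing exactly the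
    entry [lam k]; the value [lam 0] is irrelevant. *)
Definition is_length_spectrum (R : realType) (G : set 'M[R]_3)
    (lam : nat -> R) : Prop :=
  (forall j k : nat, (0 < j)%N -> (j <= k)%N -> lam j <= lam k) /\
  exists c : nat -> set 'M[R]_3,
    set_bij [set k | (0 < k)%N] (hyperbolic_classes G) c /\
    forall (k : nat) (g : 'M[R]_3), (0 < k)%N -> c k g -> lam k = hlength g.

(* Main.v *)
Require Import Defs.
From HB Require Import structures.
From mathcomp Require Import all_boot all_order all_algebra.
From mathcomp Require Import all_classical all_reals all_analysis.
From mathcomp Require Import ring lra zify.

(** The orientation-preserving isometries of the hyperbolic plane lift, up to
    sign, to unit quaternions of the even Clifford algebra of the Lorentz form.
    An isometry [g] covered by a quaternion of reduced trace [x] has matrix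
    trace [x ^ 2 - 1]; it is hyperbolic exactly when its matrix trace exceeds
    [3] ([hyperbolic_trace]), and then its length is
    [arccosh ((tr g - 1) / 2)] ([hlength_trace]).  Lengths are thus replaced by
    traces, and the statement becomes a count of conjugacy classes by trace.

    The angles determine the triangle up to isometry, and in an orthonormal
    frame with timelike vector [A] the group is generated by two rotations,
    [i] of angle [pi] about [A] and [p] of angle [pi / 5] about [B]
    ([triangle_frame], [triangle_groupP], [rotword_triangle_group]).  With
    [phi] the golden ratio and [kappa = phi + 2 = 4 cos^2 (pi / 10)], every
    element of the group lifts to a quaternion of norm one of the form
    [a0 + a1 i + b0 p + b1 i p] whose coefficients lie in [Z[phi]] up to a
    factor [sqrt kappa] ([rotword_qrot]).  The group is therefore arithmetic:
    replacing [phi] by its conjugate [1 - phi] makes the norm form positive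
    definite, so that an element of [Z[phi]] attached to a group element, such
    as its trace, has a bounded conjugate and ranges over a discrete set.

    Traces.  The bounds leave finitely many reduced traces for a hyperbolic
    element of length below the claimed [lambda_3].  The norm equation modulo
    [sqrt 5] and modulo [2] excludes all of them except [kappa] and its
    opposite ([short_trace]), which give [lambda_1 = lambda_2].

    Classes of trace [kappa].  The trace [y] of [q i], an element of [Z[phi]],
    measures the distance from [A] to the axis of [q].  The images of [A]
    under [p], [p^-1], [i p] and [i p^-1] are the neighbours of [A] in the
    tessellation by squares with centres in the orbit of [A].  When
    [|y|] is not small, one of these neighbours is nearer to the axis, so that
    conjugation makes [|y|] smaller ([real_descent], [descent_step]); as
    [y] has a bounded conjugate, this happens finitely often ([emb_gap]).  Once
    [|y|] is small, eight quaternions remain ([reduced_unit]), and explicit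
    conjugations bring each of them to [- i p^2] or to its inverse
    ([short_trace_class]).

    These two classes are distinct: modulo the prime above [2] the quaternion
    order maps onto the commutative field with sixteen elements, so the image
    of a quaternion is a conjugacy invariant, and it separates [- i p^2] from
    its inverse ([residue2_short], [qrot_short_nconj]).  Finally [i p^3] has the
    trace that corresponds to [lambda_3] ([tr_long]). *)

Set Implicit Arguments.
Unset Strict Implicit.
Unset Printing Implicit Defensive.

Import Order.TTheory GRing.Theory Num.Theory.
Local Open Scope ring_scope.

(** * Explicit 3 x 3 matrices *)
Section Mx3.
Variable R : comNzRingType.
Implicit Types a b c d e f g h k : R.

Definition mx3 a b c d e f g h k : 'M[R]_3 :=
  \matrix_(i, j) nth 0 (nth [::] [:: [:: a; b; c]; [:: d; e; f]; [:: g; h; k]] i) j.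

Lemma ord3_ind (P : 'I_3 -> Prop) : P 0 -> P 1 -> P 2 -> forall i, P i.
Proof.
move=> p0 p1 p2 [[|[|[|//]]] hi].
- by rewrite (_ : Ordinal hi = 0) //; apply: val_inj.
- by rewrite (_ : Ordinal hi = 1) //; apply: val_inj.
- by rewrite (_ : Ordinal hi = 2) //; apply: val_inj.
Qed.

Lemma big_ord3 (F : 'I_3 -> R) : \sum_i F i = F 0 + F 1 + F 2.
Proof.
rewrite !big_ord_recr big_ord0 /= add0r.
by congr (F _ + F _ + F _); apply: val_inj.
Qed.

Lemma mx3_eta (M : 'M[R]_3) :
  M = mx3 (M 0 0) (M 0 1) (M 0 2) (M 1 0) (M 1 1) (M 1 2) (M 2 0) (M 2 1) (M 2 2).
Proof.
by apply/matrixP; elim/ord3_ind; elim/ord3_ind; rewrite mxE.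
Qed.

Lemma mx3_mul a b c d e f g h k a' b' c' d' e' f' g' h' k' :
  mx3 a b c d e f g h k * mx3 a' b' c' d' e' f' g' h' k' =
  mx3 (a * a' + b * d' + c * g') (a * b' + b * e' + c * h') (a * c' + b * f' + c * k')
      (d * a' + e * d' + f * g') (d * b' + e * e' + f * h') (d * c' + e * f' + f * k')
      (g * a' + h * d' + k * g') (g * b' + h * e' + k * h') (g * c' + h * f' + k * k').
Proof.
by apply/matrixP; elim/ord3_ind; elim/ord3_ind; rewrite !mxE big_ord3 !mxE.
Qed.

Lemma mx3_1 : 1 = mx3 1 0 0 0 1 0 0 0 1.
Proof. by apply/matrixP; elim/ord3_ind; elim/ord3_ind; rewrite !mxE. Qed.

Lemma mx3_tr a b c d e f g h k : \tr (mx3 a b c d e f g h k) = a + e + k.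
Proof. by rewrite /mxtrace big_ord3 !mxE. Qed.

Lemma mx3_det a b c d e f g h k : \det (mx3 a b c d e f g h k) =
  a * (e * k - f * h) - b * (d * k - f * g) + c * (d * h - e * g).
Proof.
rewrite (expand_det_row _ 0) big_ord3 /cofactor !(expand_det_row _ 0).
rewrite !big_ord_recr !big_ord0 /= /cofactor !det_mx11 !mxE /=.
rewrite /bump /=; ring.
Qed.

End Mx3.

(** * Quaternions and rotation matrices *)
Section Quaternion.
Variable R : comNzRingType.

(** The even Clifford algebra of the form of signature (2, 1), in the basis
    [1], [i = e1 e2], [j = e1 e0], [k = e2 e0] of an orthonormal basis
    [e0, e1, e2] with [e0] timelike: [i^2 = -1], [j^2 = k^2 = 1], [j k = i]. *)
Record quat := Quat { qt0 : R; qt1 : R; qt2 : R; qt3 : R }.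

Definition qmul x y := let: Quat a0 a1 a2 a3 := x in let: Quat b0 b1 b2 b3 := y in
  Quat (a0 * b0 - a1 * b1 + a2 * b2 + a3 * b3)
       (a0 * b1 + a1 * b0 + a2 * b3 - a3 * b2)
       (a0 * b2 + a1 * b3 + a2 * b0 - a3 * b1)
       (a0 * b3 - a1 * b2 + a2 * b1 + a3 * b0).

Definition qconjug x := let: Quat a0 a1 a2 a3 := x in Quat a0 (- a1) (- a2) (- a3).

(** The matrix of [v |-> x v x'], with [x'] the conjugate of [x], on the vectors
    spanned by [e0, e1, e2]. *)
Definition rotm x : 'M[R]_3 := let: Quat h0 h1 h2 h3 := x in
  mx3 (h0 * h0 + h1 * h1 + h2 * h2 + h3 * h3)
      (2 * (h1 * h3 - h0 * h2)) (- (2 * (h0 * h3 + h1 * h2)))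
      (- (2 * (h0 * h2 + h1 * h3)))
      (h0 * h0 - h1 * h1 + h2 * h2 - h3 * h3) (2 * (h0 * h1 + h2 * h3))
      (2 * (h1 * h2 - h0 * h3)) (2 * (h2 * h3 - h0 * h1))
      (h0 * h0 - h1 * h1 - h2 * h2 + h3 * h3).

Lemma rotm_mul x y : rotm (qmul x y) = rotm x * rotm y.
Proof.
case: x y => [a0 a1 a2 a3] [b0 b1 b2 b3]; rewrite /rotm /= mx3_mul.
by congr mx3; ring.
Qed.

Lemma qconjug_mul x y : qconjug (qmul x y) = qmul (qconjug y) (qconjug x).
Proof. by case: x y => [a0 a1 a2 a3] [b0 b1 b2 b3] /=; congr Quat; ring. Qed.
Lemma qconjugK : involutive qconjug.
Proof. by case=> a0 a1 a2 a3 /=; rewrite !opprK. Qed.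

Definition qnormsq x := let: Quat a0 a1 a2 a3 := x in
  a0 * a0 + a1 * a1 - a2 * a2 - a3 * a3.

Lemma rotm_tr x : qnormsq x = 1 -> \tr (rotm x) = 4 * (qt0 x * qt0 x) - 1.
Proof.
case: x => a0 a1 a2 a3 /= n; rewrite mx3_tr; apply/eqP; rewrite eq_sym subr_eq.
by rewrite -[X in _ + X]n; apply/eqP; ring.
Qed.
End Quaternion.
Arguments Quat {R}.

(** * The ring of integers Z[phi] *)

(** [ZPhi m n] stands for [m + n phi]; it is a formal pair, to be evaluated at
    either root of [X^2 = X + 1]. *)
Record zphi := ZPhi { zre : int; zim : int }.

Definition zphi_pair (z : zphi) := (zre z, zim z).
Definition pair_zphi (p : int * int) := ZPhi p.1 p.2.
Lemma zphi_pairK : cancel zphi_pair pair_zphi.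
Proof. by case. Qed.

HB.instance Definition _ := Choice.copy zphi (can_type zphi_pairK).

Definition zphi_add x y := ZPhi (zre x + zre y) (zim x + zim y).
Definition zphi_opp x := ZPhi (- zre x) (- zim x).
Definition zphi_mul x y :=
  ZPhi (zre x * zre y + zim x * zim y)
       (zre x * zim y + zim x * zre y + zim x * zim y).

Fact zphi_addA : associative zphi_add.
Proof. by move=> x y z; congr ZPhi => /=; ring. Qed.
Fact zphi_addC : commutative zphi_add.
Proof. by move=> x y; congr ZPhi => /=; ring. Qed.
Fact zphi_add0 : left_id (ZPhi 0 0) zphi_add.
Proof. by case=> a b; congr ZPhi => /=; ring. Qed.
Fact zphi_addN : left_inverse (ZPhi 0 0) zphi_opp zphi_add.
Proof. by case=> a b; congr ZPhi => /=; ring. Qed.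
HB.instance Definition _ :=
  GRing.isZmodule.Build zphi zphi_addA zphi_addC zphi_add0 zphi_addN.

Fact zphi_mulA : associative zphi_mul.
Proof. by move=> x y z; congr ZPhi => /=; ring. Qed.
Fact zphi_mulC : commutative zphi_mul.
Proof. by move=> x y; congr ZPhi => /=; ring. Qed.
Fact zphi_mul1 : left_id (ZPhi 1 0) zphi_mul.
Proof. by case=> a b; congr ZPhi => /=; ring. Qed.
Fact zphi_mulD : left_distributive zphi_mul +%R.
Proof. by move=> x y z; congr ZPhi => /=; ring. Qed.
Fact zphi_1neq0 : ZPhi 1 0 != 0.
Proof. by []. Qed.
HB.instance Definition _ := GRing.Zmodule_isComNzRing.Build zphi
  zphi_mulA zphi_mulC zphi_mul1 zphi_mulD zphi_1neq0.

Lemma zreD x y : zre (x + y) = zre x + zre y. Proof. by []. Qed.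
Lemma zimD x y : zim (x + y) = zim x + zim y. Proof. by []. Qed.
Lemma zreN x : zre (- x) = - zre x. Proof. by []. Qed.
Lemma zimN x : zim (- x) = - zim x. Proof. by []. Qed.
Lemma zreM x y : zre (x * y) = zre x * zre y + zim x * zim y.
Proof. by []. Qed.
Lemma zimM x y :
  zim (x * y) = zre x * zim y + zim x * zre y + zim x * zim y.
Proof. by []. Qed.
Definition zphiE := (zreD, zimD, zreN, zimN, zreM, zimM).
Lemma zphiP x y : zre x = zre y -> zim x = zim y -> x = y.
Proof. by case: x y => [a b] [c d] /= -> ->. Qed.

Notation gold := (ZPhi 0 1).

(** The element [phi + 2], equal to [4 cos^2 (pi / 10)] at the golden ratio and
    to [sqrt 5] times a unit. *)
Notation kappa := (ZPhi 2 1).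

(** The exponent of [5] is even on the left and odd on the right. *)
Lemma sqr_eq5 (m n : int) : m * m = 5 * (n * n) -> n = 0.
Proof.
move=> e; apply/eqP/negPn/negP => n0.
have {}e : (`|m| * `|m| = 5 * (`|n| * `|n|))%N by rewrite -!abszM e abszM.
have ngt : (0 < `|n|)%N by rewrite absz_gt0.
have mgt : (0 < `|m|)%N by case: `|m|%N e ngt => //; case: `|n|%N.
have /(congr1 (logn 5)) := e; rewrite !lognM ?muln_gt0 ?mgt ?ngt // (pfactorK 1) //.
by move=> h; have := congr1 odd h; rewrite oddD addbb addnn /= odd_double.
Qed.

(** The product of [x] and its conjugate. *)
Definition znorm x : int := zre x * zre x + zre x * zim x - zim x * zim x.

Lemma znorm_eq0 x : znorm x = 0 -> x = 0.
Proof.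
case: x => m n; rewrite /znorm /= => e.
have n0 : n = 0.
  apply: (@sqr_eq5 (2 * m + n)).
  transitivity (4 * (m * m + m * n - n * n) + 5 * (n * n)); [ring|].
  by rewrite e mulr0 add0r.
move: e; rewrite n0 !mulr0 addr0 subr0 => /eqP; rewrite mulf_eq0 orbb => /eqP -> //.
Qed.

Section Embedding.
Variables (R : realFieldType) (phi : R).
Hypothesis phi2 : phi * phi = phi + 1.

(** Evaluation at [phi], one of the two roots. *)
Definition emb z : R := (zre z)%:~R + (zim z)%:~R * phi.

Lemma embD x y : emb (x + y) = emb x + emb y.
Proof. by rewrite /emb !zphiE !intrD; ring. Qed.
Lemma embN x : emb (- x) = - emb x.
Proof. by rewrite /emb !zphiE !intrN; ring. Qed.
Lemma embM x y : emb (x * y) = emb x * emb y.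
Proof.
rewrite /emb !zphiE !intrD !intrM.
set a : R := (zre x)%:~R; set b : R := (zim x)%:~R.
set c : R := (zre y)%:~R; set d : R := (zim y)%:~R.
have -> : (a + b * phi) * (c + d * phi) =
  a * c + (a * d + b * c) * phi + b * d * (phi * phi) by ring.
by rewrite phi2; ring.
Qed.
Lemma emb0 : emb 0 = 0. Proof. by rewrite /emb /= mul0r addr0. Qed.
Lemma emb1 : emb 1 = 1. Proof. by rewrite /emb /= mul0r addr0. Qed.
Lemma emb_nat n : emb n%:R = n%:R.
Proof. by elim: n => [|n IH]; rewrite ?emb0 // !mulrS embD emb1 IH. Qed.
Lemma emb_gold : emb gold = phi.
Proof. by rewrite /emb /= mul1r add0r. Qed.
Lemma emb_kappa : emb kappa = phi + 2.
Proof. by rewrite /emb /= mul1r addrC. Qed.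

End Embedding.

(** * Integral quaternions *)

(** Coordinates of [a0 + a1 i + b0 p + b1 i p], where [p] is the quaternion of a
    rotation of angle [pi / 5] and satisfies [p^2 = - sqrt kappa p - 1],
    [p i = sqrt kappa (1 - i) - i p].  The group elements that use [p] an even
    number of times have [a0, a1] in [Z[phi]] and [b0, b1] in
    [sqrt kappa Z[phi]]; for the odd ones the roles are exchanged.  The record
    stores the coordinates with the factor [sqrt kappa] removed and the boolean
    tells where it was, so that all computations stay in [Z[phi]]. *)
Record qint := QInt { qodd : bool; qa0 : zphi; qa1 : zphi; qb0 : zphi; qb1 : zphi }.

(** The squares of the factors removed from [a0, a1] and from [b0, b1]; their
    product is [kappa] in both cases. *)
Definition weight_a (o : bool) : zphi := if o then kappa else 1.
Definition weight_b (o : bool) : zphi := if o then 1 else kappa.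

Definition qnorm f :=
  weight_a (qodd f) * (qa0 f * qa0 f + qa1 f * qa1 f)
  + weight_b (qodd f) * (qb0 f * qb0 f + qb1 f * qb1 f)
  + kappa * (qa0 f * (qb1 f - qb0 f) - qa1 f * (qb0 f + qb1 f)).

(** The reduced traces of the quaternion [q] and of [q i], both divided by the
    factor removed from [a0, a1].  The second one vanishes when the axis of [q]
    passes through the fixed point of [i]. *)
Definition qtr f := 2 * qa0 f + weight_b (qodd f) * (qb1 f - qb0 f).
Definition qtr_i f := weight_b (qodd f) * (qb0 f + qb1 f) - 2 * qa1 f.

Lemma kappaE : kappa = gold + 2. Proof. by []. Qed.
Lemma gold2 : gold * gold = gold + 1. Proof. by []. Qed.

(** The norm form in orthogonal coordinates.  Since [gold] is positive and its
    conjugate is negative, the form is indefinite and its conjugate is positive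
    definite. *)
Lemma four_qnorm f : 4 * qnorm f =
  weight_a (qodd f) * (qtr f * qtr f + qtr_i f * qtr_i f)
  - 2 * gold * weight_b (qodd f) * (qb0 f * qb0 f + qb1 f * qb1 f).
Proof.
case: f => -[] a0 a1 b0 b1; rewrite /qnorm /qtr /qtr_i /weight_a /weight_b /= kappaE.
  move: gold => g; ring.
have h := gold2; move: gold h => g h.
ring: h.
Qed.

(** Left multiplications by [i], [p] and [p^-1], and quaternionic conjugation. *)
Definition qmul_i f := QInt (qodd f) (- qa1 f) (qa0 f) (- qb1 f) (qb0 f).
Definition qmul_p f :=
  let u := weight_a (qodd f) in let w := weight_b (qodd f) in
  QInt (~~ qodd f) (u * qa1 f - qb0 f) (qb1 f - u * qa1 f)
    (qa0 f - w * qb0 f + w * qb1 f) (- qa1 f).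
Definition qmul_pV f :=
  let u := weight_a (qodd f) in let w := weight_b (qodd f) in
  QInt (~~ qodd f) (qb0 f - u * qa0 f - u * qa1 f) (- qb1 f)
    (- qa0 f - w * qb1 f) (qa1 f - w * qb1 f).
Definition qbar f := let w := weight_b (qodd f) in
  QInt (qodd f) (qa0 f - w * qb0 f + w * qb1 f) (- qa1 f) (- qb0 f) (- qb1 f).
Definition qneg f := QInt (qodd f) (- qa0 f) (- qa1 f) (- qb0 f) (- qb1 f).
Definition qone := QInt false 1 0 0 0.

Lemma qnorm_i f : qnorm (qmul_i f) = qnorm f.
Proof.
case: f => o a0 a1 b0 b1; rewrite /qnorm /qmul_p /qmul_pV /qbar /weight_a /weight_b.
by move: kappa => k; case: o => /=; ring. Qed.
Lemma qnorm_p f : qnorm (qmul_p f) = qnorm f.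
Proof.
case: f => o a0 a1 b0 b1; rewrite /qnorm /qmul_p /qmul_pV /qbar /weight_a /weight_b.
by move: kappa => k; case: o => /=; ring.
Qed.
Lemma qnorm_pV f : qnorm (qmul_pV f) = qnorm f.
Proof.
case: f => o a0 a1 b0 b1; rewrite /qnorm /qmul_p /qmul_pV /qbar /weight_a /weight_b.
by move: kappa => k; case: o => /=; ring.
Qed.
Lemma qnorm_bar f : qnorm (qbar f) = qnorm f.
Proof.
case: f => o a0 a1 b0 b1; rewrite /qnorm /qmul_p /qmul_pV /qbar /weight_a /weight_b.
by move: kappa => k; case: o => /=; ring.
Qed.
Lemma qnorm_neg f : qnorm (qneg f) = qnorm f.
Proof.
case: f => o a0 a1 b0 b1; rewrite /qnorm /qmul_p /qmul_pV /qbar /weight_a /weight_b.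
by move: kappa => k; case: o => /=; ring. Qed.

(** * The trace of a short element *)
Section Bounds.
Variables (R : realFieldType) (phi : R).
Hypothesis phi2 : phi * phi = phi + 1.
Hypothesis phi_gt0 : 0 < phi.
Let psi := 1 - phi.

Lemma psi2 : psi * psi = psi + 1.
Proof. by rewrite /psi; have := phi2; nra. Qed.

Lemma sqr_ltl (x k : R) : 0 <= k -> x * x < k * k -> x < k.
Proof.
by move=> k0 h; rewrite ltNge; apply/negP => kx; move: h; rewrite ltNge ler_pM.
Qed.
Lemma sqr_gtl (x k : R) : 0 <= x -> k * k < x * x -> k < x.
Proof. exact: sqr_ltl. Qed.
Lemma sqr_norm (x k : R) : 0 <= k -> x * x <= k * k -> - k <= x /\ x <= k.
Proof.
move=> k0 h; split; rewrite leNgt; apply/negP => kx; move: h; rewrite leNgt.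
  by rewrite -[x * x]mulrNN ltr_pM // ltrNr.
by rewrite ltr_pM.
Qed.

Lemma gold_lb : 161 / 100 < phi.
Proof. by have := phi2; have := phi_gt0; nra. Qed.
Lemma gold_ub : phi < 162 / 100.
Proof. by have := phi2; have := phi_gt0; nra. Qed.

(** The two embeddings of [m + n phi] differ by [n (2 phi - 1)], where
    [2 phi - 1 = sqrt 5], so bounds on both bound [n], and then [m].  The bound
    [7 + 11 phi] is [kappa phi^4], the square of the reduced trace that
    corresponds to [lambda_3]. *)
Lemma small_even_trace (x : zphi) : 4 < emb phi (x * x) -> emb phi (x * x) < 7 + 11 * phi ->
  emb psi (x * x) <= 4 ->
  let l := [:: gold * gold; kappa; 2 * gold; ZPhi 1 2; 3 * gold] in
  x \in l \/ - x \in l.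
Proof.
rewrite !embM ?psi2 //.
have lb := gold_lb; have ub := gold_ub.
wlog : x / 0 < emb phi x.
  move=> W; case: (ltrgtP (emb phi x) 0) => [xneg|xpos|->]; last by lra.
    have := W (- x); rewrite !embN oppr_gt0 => /(_ xneg).
    rewrite !mulrNN opprK => + h1 h2 h3 => /(_ h1 h2 h3) /=; tauto.
  exact: W.
case: x => m n; rewrite /emb /psi /=.
set a : R := m%:~R; set b : R := n%:~R => xgt0 h1 h2 h3.
(* [4.99^2 > 7 + 11 * 1.62] *)
have [[x_gt x_lt] [y_gt y_lt]] :
    (2 < a + b * phi /\ a + b * phi < 499 / 100) /\
    (- 2 <= a + b * (1 - phi) /\ a + b * (1 - phi) <= 2).
  move: (a + b * phi) (a + b * (1 - phi)) xgt0 h1 h2 h3 => x y x0 h1 h2 h3.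
  by split; [split; [apply: sqr_gtl|apply: sqr_ltl]|apply: sqr_norm]; lra.
move: xgt0 h1 h2 h3 => _ _ _ _.
have b_gt : 0 < b.
  by rewrite -(@pmulr_lgt0 _ (2 * phi - 1)); lra.
have b_lt : b < 4.
  by rewrite -(@ltr_pM2r _ (2 * phi - 1)); lra.
have n_gt : 0 < n by rewrite -(ltr0z R).
have n_lt : n < 4 by rewrite -(ltr_int R).
left.
have : n = 1 \/ n = 2 \/ n = 3 by move: n_gt n_lt; clear; lia.
have eb : b = n%:~R by []. have ea : a = m%:~R by [].
case=> [|[]] en; rewrite {}en in eb *; rewrite {b}eb in b_gt b_lt x_gt x_lt y_lt y_gt.
- have m1 : 0 < m by rewrite -(ltr0z R) -ea; lra.
  have m2 : m < 3 by rewrite -(ltr_int R) -ea; lra.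
  have : m = 1 \/ m = 2 by move: m1 m2; clear; lia.
  by case=> ->.
- have m1 : -1 < m by rewrite -(ltr_int R) -ea; lra.
  have m2 : m < 2 by rewrite -(ltr_int R) -ea; lra.
  have : m = 0 \/ m = 1 by move: m1 m2; clear; lia.
  by case=> ->.
- have m1 : -1 < m by rewrite -(ltr_int R) -ea; lra.
  have m2 : m < 1 by rewrite -(ltr_int R) -ea; lra.
  have : m = 0 by move: m1 m2; clear; lia.
  by move=> ->.
Qed.

Lemma small_odd_trace (x : zphi) : 4 < emb phi (kappa * (x * x)) ->
  emb phi (kappa * (x * x)) < 7 + 11 * phi ->
  emb psi (kappa * (x * x)) <= 4 -> x = gold \/ - x = gold.
Proof.
rewrite !embM ?psi2 // !emb_kappa.
have lb := gold_lb; have ub := gold_ub.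
wlog : x / 0 < emb phi x.
  move=> W; case: (ltrgtP (emb phi x) 0) => [xneg|xpos|->]; last by move=> *; exfalso; lra.
    have := W (- x); rewrite !embN oppr_gt0 => /(_ xneg).
    rewrite !mulrNN opprK => + h1 h2 h3 => /(_ h1 h2 h3) /=; tauto.
  exact: W.
case: x => m n; rewrite /emb /psi /=.
set a : R := m%:~R; set b : R := n%:~R => xgt0 h1 h2 h3.
(* [3.62 * 1.05^2 < 4 < 1.38 * 1.71^2], with [phi + 2 < 3.62] and [3 - phi > 1.38] *)
have [x_gt [y_gt y_lt]] : 21 / 20 < a + b * phi /\
    - (171 / 100) <= a + b * (1 - phi) /\ a + b * (1 - phi) <= 171 / 100.
  move: (a + b * phi) (a + b * (1 - phi)) xgt0 h1 h3 {h2} => x y x0 h1 h3.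
  split; [apply: sqr_gtl; first lra|apply: sqr_norm; first lra].
    by rewrite -(@ltr_pM2l _ (phi + 2)); lra.
  by rewrite -(@ler_pM2l _ (1 - phi + 2)); lra.
have x_lt : a + b * phi < 1 + phi.
  rewrite ltNge; apply/negP => h; move: h1 h3 y_gt y_lt => _ _ _ _.
  have h4 : (1 + phi) * (1 + phi) <= (a + b * phi) * (a + b * phi) by apply: ler_pM; lra.
  have : (phi + 2) * ((1 + phi) * (1 + phi)) <= (phi + 2) * ((a + b * phi) * (a + b * phi)).
    by rewrite ler_wpM2l //; lra.
  have -> : (phi + 2) * ((1 + phi) * (1 + phi)) = 7 + 11 * phi; last by lra.
  have -> : (phi + 2) * ((1 + phi) * (1 + phi)) =
    (phi * phi) * phi + 4 * (phi * phi) + 5 * phi + 2 by ring.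
  by rewrite phi2 mulrDl phi2; ring.
move: xgt0 h1 h2 h3 => _ _ _ _.
have b_gt : -1 < b.
  by rewrite -(@ltr_pM2r _ (2 * phi - 1)); lra.
have b_lt : b < 2.
  by rewrite -(@ltr_pM2r _ (2 * phi - 1)); lra.
have n_gt : -1 < n by rewrite -(ltr_int R).
have n_lt : n < 2 by rewrite -(ltr_int R).
left.
have : n = 0 \/ n = 1 by move: n_gt n_lt; clear; lia.
have eb : b = n%:~R by []. have ea : a = m%:~R by [].
case=> en; rewrite {}en in eb *; rewrite {b}eb in b_gt b_lt x_gt x_lt y_lt y_gt.
- have m1 : 1 < m by rewrite -(ltr_int R) -ea; lra.
  have m2 : m < 2 by rewrite -(ltr_int R) -ea; lra.
  by move: m1 m2; clear; lia.
- have m1 : -1 < m by rewrite -(ltr_int R) -ea; lra.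
  have m2 : m < 1 by rewrite -(ltr_int R) -ea; lra.
  have : m = 0 by move: m1 m2; clear; lia.
  by move=> ->.
Qed.
End Bounds.

Definition parity (z : int) : bool := odd `|z|.
Lemma parityN x : parity (- x) = parity x.
Proof. by rewrite /parity abszN. Qed.
Lemma parityM x y : parity (x * y) = parity x && parity y.
Proof. by rewrite /parity abszM oddM. Qed.
Lemma parityD x y : parity (x + y) = parity x (+) parity y.
Proof. 
have h z : parity z = (z%:~R != 0 :> 'F_2).
  rewrite [in RHS](intEsign z) rmorphM /= rmorphXn rmorphN1 mulf_eq0 negb_or.
  rewrite expf_neq0 ?oppr_eq0 ?oner_eq0 //=.
  rewrite -(dvdn_pcharf (pchar_Fp (isT : prime 2))) dvdn2 negbK //.
rewrite !h rmorphD /=.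
by move: (x%:~R : 'F_2) (y%:~R : 'F_2) => [[|[|?]] ?] [[|[|?]] ?].
Qed.

Lemma sqr_mod5 (y k : int) : y * y <> 3 + 5 * k.
Proof.
move=> h; have yE := divz_eq y 5.
have r0 : 0 <= (y %% 5)%Z by exact: modz_ge0.
have r5 : (y %% 5)%Z < 5 by exact: ltz_pmod.
move: (y %/ 5)%Z (y %% 5)%Z yE r0 r5 h => q r -> r0 r5.
have : r = 0 \/ r = 1 \/ r = 2 \/ r = 3 \/ r = 4 by move: r0 r5; clear; lia.
have -> : (q * 5 + r) * (q * 5 + r) = 5 * (5 * (q * q) + 2 * (q * r)) + r * r by ring.
move: (5 * (q * q) + 2 * (q * r)) => z.
by move=> [|[|[|[|]]]] ->; clear; lia.
Qed.

(** The ring morphism from [Z[phi]] to the integers modulo 5 that sends [phi] to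
    [3] kills [kappa], so the norm equation reduces to the statement that the
    image of [qtr_i] is a square root of [4] minus the square of the trace. *)
Lemma qtr_i_mod5 f (y := zre (qtr_i f) + 3 * zim (qtr_i f)) :
  qnorm f = 1 -> qodd f = false ->
  exists k, y * y = 4 + 5 * k -
                 (zre (qtr f * qtr f) + 3 * zim (qtr f * qtr f)).
Proof.
move=> n1 o; have := four_qnorm f; rewrite n1 o mulr1 /weight_a /weight_b mul1r.
move: (qb0 f * _ + _) => B; rewrite /y; move: (qtr_i f) (qtr f * _) => e t h.
exists (4 * zre B + 6 * zim B + zim e * zim e).
have h0 : 4 = zre t + (zre e * zre e + zim e * zim e) - 2 * (zre B + 3 * zim B).
  by apply: (etrans (congr1 zre h)); rewrite !zphiE /=; ring.
have h1 : 0 = zim t + (zre e * zim e + zim e * zre e + zim e * zim e)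
   - 2 * (3 * zre B + 4 * zim B).
  by apply: (etrans (congr1 zim h)); rewrite !zphiE /=; ring.
apply/eqP; rewrite -subr_eq0; apply/eqP.
transitivity ((zre t + (zre e * zre e + zim e * zim e) - 2 * (zre B + 3 * zim B) - 4)
 + 3 * (zim t + (zre e * zim e + zim e * zre e + zim e * zim e)
   - 2 * (3 * zre B + 4 * zim B))); first by ring.
by rewrite -h0 -h1; ring.
Qed.

Definition zparity (z : zphi) := (parity (zre z), parity (zim z)).

(** The norm equation has no solution modulo 2 with this trace; the eight bits
    of the coordinates leave finitely many cases. *)
Lemma even_trace_parity f : qnorm f = 1 -> qodd f = false ->
  zparity (qtr f) <> (true, false).
Proof.
case: f => o a0 a1 b0 b1 /= + oE; rewrite {o}oE.
move=> n1; have := congr1 zparity n1; rewrite /zparity !zphiE /= !(parityD, parityM, parityN).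
have [p0 p1] : parity 0 = false /\ parity 1 = true by [].
rewrite ?p0 ?p1 {p0 p1}.
move: (parity (zre a0)) (parity (zim a0)) (parity (zre a1)) (parity (zim a1)) => [] [] [] [].
all: by move: (parity (zre b0)) (parity (zim b0)) (parity (zre b1)) (parity (zim b1))
  => [] [] [] [].
Qed.

Lemma odd_trace_parity f : qnorm f = 1 -> qodd f = true ->
  zparity (qtr f) <> (false, true).
Proof.
case: f => o a0 a1 b0 b1 /= + oE; rewrite {o}oE.
move=> n1; have := congr1 zparity n1; rewrite /zparity !zphiE /= !(parityD, parityM, parityN).
have [p0 p1] : parity 0 = false /\ parity 1 = true by [].
rewrite ?p0 ?p1 {p0 p1}.
move: (parity (zre a0)) (parity (zim a0)) (parity (zre a1)) (parity (zim a1)) => [] [] [] [].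
all: by move: (parity (zre b0)) (parity (zim b0)) (parity (zre b1)) (parity (zim b1))
  => [] [] [] [].
Qed.

Section Pin.
Variables (R : realFieldType) (phi : R).
Hypothesis phi2 : phi * phi = phi + 1.
Hypothesis phi_gt0 : 0 < phi.
Let psi := 1 - phi.

(** At the conjugate [1 - phi] the last term of [four_qnorm] is non-negative. *)
Lemma conj_bound f : qnorm f = 1 ->
  emb psi (weight_a (qodd f) * (qtr f * qtr f)) +
  emb psi (weight_a (qodd f) * (qtr_i f * qtr_i f)) <= 4.
Proof.
move=> n1; pose B := qb0 f * qb0 f + qb1 f * qb1 f.
have e : 4 = weight_a (qodd f) * (qtr f * qtr f) + weight_a (qodd f) * (qtr_i f * qtr_i f)
             - (2 * gold) * (weight_b (qodd f) * B).
  by have := four_qnorm f; rewrite n1 mulr1 => ->; rewrite -mulrDr mulrA.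
have {e} : emb psi 4 = emb psi (weight_a (qodd f) * (qtr f * qtr f))
    + emb psi (weight_a (qodd f) * (qtr_i f * qtr_i f))
    - emb psi (2 * gold) * emb psi (weight_b (qodd f) * B).
  by rewrite [in LHS]e [LHS]embD [X in X + _]embD embN [X in _ - X](embM (psi2 phi2)).
have lb := gold_lb phi2 phi_gt0; have ub := gold_ub phi2 phi_gt0.
rewrite emb_nat [emb psi (2 * _)]embM ?psi2 // emb_nat emb_gold.
have Bge0 : 0 <= emb psi (weight_b (qodd f) * B).
  rewrite embM ?psi2 // mulr_ge0 //.
    by case: (qodd f); rewrite /weight_b ?emb_kappa ?emb1 /psi; lra.
  by rewrite /B embD !embM ?psi2 // addr_ge0 // -expr2 sqr_ge0.
move=> ->; rewrite lerDl oppr_ge0 mulr_le0_ge0 // /psi; lra.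
Qed.

Lemma emb_sqr_ge0 (chi : R) (z : zphi) : chi * chi = chi + 1 -> 0 <= emb chi (z * z).
Proof. by move=> h; rewrite embM // -expr2 sqr_ge0. Qed.

(** In the even case the bounds leave [phi^2], [kappa], [2 phi], [phi^3] and
    [3 phi].  Modulo [sqrt 5] the first, third and fifth would make [3] a
    square, and [phi^3] is excluded modulo 2.  In the odd case only [phi] is
    left, and it is excluded modulo 2. *)
Lemma short_trace f : qnorm f = 1 ->
  4 < emb phi (weight_a (qodd f) * (qtr f * qtr f)) ->
  emb phi (weight_a (qodd f) * (qtr f * qtr f)) < 7 + 11 * phi ->
  qodd f = false /\ (qtr f = kappa \/ qtr f = - kappa).
Proof.
move=> n1 h1 h2.
have h3 : emb psi (weight_a (qodd f) * (qtr f * qtr f)) <= 4.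
  apply: le_trans (conj_bound n1); rewrite lerDl embM ?psi2 //.
  rewrite mulr_ge0 ?emb_sqr_ge0 ?psi2 //.
  have lb := gold_lb phi2 phi_gt0; have ub := gold_ub phi2 phi_gt0.
  by case: (qodd f); rewrite /weight_a ?emb_kappa ?emb1 /psi; lra.
move: h1 h2 h3; case o: (qodd f); rewrite /weight_a ?mul1r => h1 h2 h3.
  have p := odd_trace_parity n1 o.
  case: (small_odd_trace phi2 phi_gt0 h1 h2 h3) => e; case: p; first by rewrite e.
  by rewrite -[qtr f]opprK e.
split=> //.
have p := even_trace_parity n1 o.
have [k] := qtr_i_mod5 n1 o.
set y := _ + 3 * _ => yk.
have pm : forall z, qtr f = z \/ - qtr f = z -> z \in
  [:: gold * gold; kappa; 2 * gold; ZPhi 1 2; 3 * gold] -> z = kappa.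
  move=> z zE; have sE : qtr f * qtr f = z * z.
    by case: zE => <- //; rewrite mulrNN.
  rewrite sE in yk.
  have no : forall r : int, zre (z * z) + 3 * zim (z * z) = 5 * r + 1 -> False.
    by move=> r hr; apply: (@sqr_mod5 y (k - r)); rewrite yk hr; ring.
  rewrite !inE => /or4P [/eqP zz|/eqP -> //|/eqP zz|/orP[] /eqP zz].
  - by case: (no 2); rewrite zz.
  - by case: (no 3); rewrite zz.
  - case: p; case: zE => [->|/eqP]; rewrite zz // eqr_oppLR => /eqP -> //.
  - by case: (no 7); rewrite zz.
have [h|h] := small_even_trace phi2 phi_gt0 h1 h2 h3.
  by left; apply: pm h; left.
by right; rewrite -(pm _ (or_intror erefl) h) opprK.
Qed.
End Pin.

(** * Conjugation in the group *)

(** With [q'] for the conjugate quaternion, [(p (p q)')' = p q p'], so that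
    conjugation is expressed through left multiplication and [qbar]. *)
Definition conj_i f := qbar (qmul_i (qbar (qmul_i f))).
Definition conj_p f := qbar (qmul_p (qbar (qmul_p f))).
Definition conj_pV f := qbar (qmul_pV (qbar (qmul_pV f))).

Inductive qconj : qint -> qint -> Prop :=
| qconj_refl f : qconj f f
| qconj_i f g : qconj (conj_i f) g -> qconj f g
| qconj_p f g : qconj (conj_p f) g -> qconj f g
| qconj_pV f g : qconj (conj_pV f) g -> qconj f g.

(** The quaternion [- i p^2]. *)
Definition qshort := QInt false 0 1 0 1.

Lemma qnorm_conj_i f : qnorm (conj_i f) = qnorm f.
Proof. by rewrite /conj_i !(qnorm_bar, qnorm_i). Qed.
Lemma qnorm_conj_p f : qnorm (conj_p f) = qnorm f.
Proof. by rewrite /conj_p !(qnorm_bar, qnorm_p). Qed.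
Lemma qnorm_conj_pV f : qnorm (conj_pV f) = qnorm f.
Proof. by rewrite /conj_pV !(qnorm_bar, qnorm_pV). Qed.

Lemma conj_i_data f : qodd f = false ->
  [/\ qodd (conj_i f) = false, qtr (conj_i f) = qtr f, qtr_i (conj_i f) = qtr_i f,
   qb0 (conj_i f) = - qb0 f & qb1 (conj_i f) = - qb1 f].
Proof.
case: f => o a0 a1 b0 b1 /= ->.
rewrite /qtr /qtr_i /conj_i /qbar /qmul_i /= /weight_b; move: kappa => k.
by split=> //; ring.
Qed.

Lemma conj_p_data f : qodd f = false ->
  [/\ qodd (conj_p f) = false, qtr (conj_p f) = qtr f &
      qtr_i (conj_p f) = gold * gold * qtr_i f - gold * kappa * (qb0 f + qb1 f)].
Proof.
case: f => o a0 a1 b0 b1 /= ->.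
rewrite /qtr /qtr_i /conj_p /qbar /qmul_p /= /weight_b /weight_a kappaE.
have h := gold2; move: gold h => g h.
by split=> //; ring: h.
Qed.

Lemma conj_pV_data f : qodd f = false ->
  [/\ qodd (conj_pV f) = false, qtr (conj_pV f) = qtr f &
      qtr_i (conj_pV f) = gold * gold * qtr_i f + gold * kappa * (qb1 f - qb0 f)].
Proof.
case: f => o a0 a1 b0 b1 /= ->.
rewrite /qtr /qtr_i /conj_pV /qbar /qmul_pV /= /weight_b /weight_a kappaE.
have h := gold2; move: gold h => g h.
by split=> //; ring: h.
Qed.

(** * Descent to the two shortest classes *)
Section Descent.
Variables (R : realFieldType) (phi : R).
Hypothesis phi2 : phi * phi = phi + 1.
Hypothesis phi_gt0 : 0 < phi.
Let psi := 1 - phi.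

Lemma emb_conjM z : emb phi z * emb psi z = (znorm z)%:~R.
Proof.
rewrite /emb /znorm !(intrD, intrM, intrN) /psi.
move: (zre z)%:~R (zim z)%:~R => m n.
have -> : (m + n * phi) * (m + n * (1 - phi)) =
  m * m + m * n - n * n * (phi * phi - phi) by ring.
by rewrite phi2; ring.
Qed.

(** The product of a nonzero element of [Z[phi]] and its conjugate is a nonzero
    integer. *)
Lemma emb_gap z : 0 < emb phi z -> `|emb psi z| <= 4 -> 1 <= 4 * emb phi z.
Proof.
move=> z0 zc; have nz : znorm z != 0.
  by apply: contraL z0 => /eqP/znorm_eq0 ->; rewrite emb0 ltxx.
have : 1 <= `|emb phi z * emb psi z|.
  by rewrite emb_conjM -intr_norm (ler_int _ 1) -gtz0_ge1 normr_gt0.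
move/le_trans; apply; rewrite normrM gtr0_norm // mulrC.
by rewrite ler_wpM2r // ltW.
Qed.

(** [Y] is the trace of [q i], and the left-hand sides below are the traces that
    replace it after the conjugations by [p], [p i], [p^-1] and [p^-1 i].  The
    identity is the norm equation for trace [kappa], with
    [kappa^2 - 4 = 1 + 5 phi] and [phi kappa = 1 + 3 phi].  The larger of
    [|b0 + b1|] and [|b1 - b0|] has its square between [b0^2 + b1^2] and twice
    this sum.  Let [s] be plus or minus that number, with the sign opposite to
    [Y]; then [phi |s| < |Y| < kappa |s|].  The upper bound expresses that the
    pole of the axis is spacelike, whereas the cone over the square around [A]
    is timelike; the lower one is the hypothesis that [Y] is large. *)
Lemma real_descent (Y b0 b1 : R) :
  Y * Y + (1 + 5 * phi) = 2 * (1 + 3 * phi) * (b0 * b0 + b1 * b1) ->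
  5 + 6 * phi < 2 * (Y * Y) ->
  exists2 s, s \in [:: b0 + b1; - (b0 + b1); b1 - b0; - (b1 - b0)] &
    `|(phi + 1) * Y + (1 + 3 * phi) * s| < `|Y|.
Proof.
have lb := gold_lb phi2 phi_gt0; have ub := gold_ub phi2 phi_gt0.
move=> e hY; set B := b0 * b0 + b1 * b1 in e.
have sum : (b0 + b1) * (b0 + b1) + (b1 - b0) * (b1 - b0) = 2 * B.
  by rewrite /B; ring.
clearbody B.
have [S Sin [S1 S2]] : exists2 S, S \in [:: b0 + b1; b1 - b0] &
    B <= S * S /\ S * S <= 2 * B.
  have p1 : 0 <= (b0 + b1) * (b0 + b1) by rewrite -expr2 sqr_ge0.
  have p2 : 0 <= (b1 - b0) * (b1 - b0) by rewrite -expr2 sqr_ge0.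
  case: (lerP B ((b0 + b1) * (b0 + b1))) => h.
    exists (b0 + b1); rewrite ?inE ?eqxx //; split=> //.
    by rewrite -sum lerDl.
  exists (b1 - b0); rewrite ?inE ?eqxx ?orbT //; split; last by rewrite -sum lerDr.
  move: sum h; set x := (b0 + b1) * _; set y := (b1 - b0) * _ => sum h.
  by clearbody x y; lra.
have [s sin [ss sY]] : exists2 s,
    s \in [:: b0 + b1; - (b0 + b1); b1 - b0; - (b1 - b0)] &
    s * s = S * S /\ Y * s <= 0.
  have i1 : S \in [:: b0 + b1; - (b0 + b1); b1 - b0; - (b1 - b0)].
    by move: Sin; rewrite !inE => /orP[] ->; rewrite ?orbT.
  have i2 : - S \in [:: b0 + b1; - (b0 + b1); b1 - b0; - (b1 - b0)].
    by move: Sin; rewrite !inE => /orP[] /eqP ->; rewrite eqxx ?orbT.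
  case: (lerP (Y * S) 0) => h; first by exists S.
  by exists (- S) => //; rewrite mulrNN mulrN oppr_le0 ltW.
exists s => //.
rewrite -{}ss in S1 S2.
have h1 : phi * s * (phi * s) < Y * Y.
  have -> : phi * s * (phi * s) = (phi + 1) * (s * s) by rewrite -phi2; ring.
  have S3 : (phi + 1) * (s * s) <= (phi + 1) * (2 * B) by rewrite ler_wpM2l //; lra.
  apply: le_lt_trans S3 _.
  rewrite -(@ltr_pM2l _ (1 + 3 * phi)); last lra.
  have -> : (1 + 3 * phi) * ((phi + 1) * (2 * B)) = (phi + 1) * (2 * (1 + 3 * phi) * B) by ring.
  rewrite -e -subr_gt0.
  have -> : (1 + 3 * phi) * (Y * Y) - (phi + 1) * (Y * Y + (1 + 5 * phi)) =
    phi * (2 * (Y * Y)) - (1 + 6 * phi + 5 * (phi * phi)) by ring.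
  rewrite phi2.
  have : phi * (5 + 6 * phi) < phi * (2 * (Y * Y)) by rewrite ltr_pM2l.
  have -> : phi * (5 + 6 * phi) = 5 * phi + 6 * (phi * phi) by ring.
  by rewrite phi2; lra.
have h2 : Y * Y < (phi + 2) * s * ((phi + 2) * s).
  have -> : (phi + 2) * s * ((phi + 2) * s) = (phi * phi + 4 * phi + 4) * (s * s) by ring.
  rewrite phi2.
  have : 2 * (1 + 3 * phi) * B <= 2 * (1 + 3 * phi) * (s * s).
    by rewrite ler_wpM2l //; lra.
  have : 0 <= s * s by rewrite -expr2 sqr_ge0.
  have : 0 <= (2 - phi) * (s * s) by rewrite mulr_ge0 ?subr_ge0 -?expr2 ?sqr_ge0; lra.
  lra.
have fin (y t : R) : 0 <= y -> 0 <= t -> phi * t * (phi * t) < y * y ->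
    y * y < (phi + 2) * t * ((phi + 2) * t) ->
    `|(phi + 1) * y - (1 + 3 * phi) * t| < y.
  move=> y0 t0 k1 k2.
  have {}k1 : phi * t < y by apply: sqr_ltl.
  have {}k2 : y < (phi + 2) * t by apply: sqr_ltl k2; rewrite mulr_ge0 //; lra.
  rewrite ltr_norml; apply/andP; split.
    have : (phi + 2) * (phi * t) < (phi + 2) * y by rewrite ltr_pM2l //; lra.
    have -> : (phi + 2) * (phi * t) = (phi * phi + 2 * phi) * t by ring.
    by rewrite phi2; lra.
  have : phi * y < phi * ((phi + 2) * t) by rewrite ltr_pM2l.
  have -> : phi * ((phi + 2) * t) = (phi * phi + 2 * phi) * t by ring.
  by rewrite phi2; lra.
case: (lerP 0 Y) => Y0.
  rewrite (ger0_norm Y0) -[s]opprK mulrN.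
  have s0 : 0 <= - s.
    case: (lerP 0 (- s)) => // sn; have Yz : Y = 0.
      apply/eqP; rewrite eq_le Y0 andbT -(@pmulr_lle0 _ s) // -oppr_lt0 //.
    by move: hY; rewrite Yz; lra.
  by apply: fin => //; rewrite !mulrN ?mulNr ?opprK //.
rewrite (ltr0_norm Y0) -normrN opprD -mulrN.
have s0 : 0 <= s by rewrite -(@nmulr_rle0 _ Y).
by apply: fin => //; rewrite ?mulrNN // oppr_ge0 ltW.
Qed.

Lemma small_unit (b : zphi) : emb phi (b * b) <= 1 -> emb psi (b * b) <= 1 ->
  b \in [:: 0; 1; -1].
Proof.
have lb := gold_lb phi2 phi_gt0; have ub := gold_ub phi2 phi_gt0.
rewrite !embM ?psi2 //; case: b => m n; rewrite /emb /=.
set a : R := m%:~R; set c : R := n%:~R => h1 h2.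
have [x1 x2] : - 1 <= a + c * phi /\ a + c * phi <= 1.
  by apply: sqr_norm; rewrite ?ler01 ?mulr1.
have [y1 y2] : - 1 <= a + c * psi /\ a + c * psi <= 1.
  by apply: sqr_norm; rewrite ?ler01 ?mulr1.
move: h1 h2 => _ _; rewrite /psi in y1 y2.
have c1 : -1 < c by rewrite -(@ltr_pM2r _ (2 * phi - 1)); lra.
have c2 : c < 1 by rewrite -(@ltr_pM2r _ (2 * phi - 1)); lra.
have n1 : -1 < n by rewrite -(ltr_int R).
have n2 : n < 1 by rewrite -(ltr_int R).
have nE : n = 0 by move: n1 n2; clear; lia.
have cE : c = n%:~R by []. have ea : a = m%:~R by [].
rewrite {}nE in cE *; rewrite {c}cE in x1 x2 y1 y2 c1 c2.
have m1 : -2 < m by rewrite -(ltr_int R) -ea; lra.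
have m2 : m < 2 by rewrite -(ltr_int R) -ea; lra.
have : m = 0 \/ m = 1 \/ m = - 1 by move: m1 m2; clear; lia.
by case=> [|[]] ->.
Qed.

Lemma small_qtr_i (x : zphi) : 2 * emb phi (x * x) <= 5 + 6 * phi ->
  emb psi (x * x) <= 21 / 10 ->
  x \in [:: 0; 1; -1; gold; - gold; gold * gold; - (gold * gold)].
Proof.
have lb := gold_lb phi2 phi_gt0; have ub := gold_ub phi2 phi_gt0.
rewrite !embM ?psi2 //; case: x => m n; rewrite /emb /=.
set a : R := m%:~R; set c : R := n%:~R => h1 h2.
(* [2.72^2 > (5 + 6 * 1.62) / 2] and [1.45^2 > 2.1] *)
have [x1 x2] : - (272 / 100) <= a + c * phi /\ a + c * phi <= 272 / 100.
  by apply: sqr_norm; first lra; move: (a + c * phi) h1 => X h1; lra.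
have [y1 y2] : - (145 / 100) <= a + c * psi /\ a + c * psi <= 145 / 100.
  by apply: sqr_norm; first lra; move: (a + c * psi) h2 => X h2; lra.
move: h1 h2 => _ _; rewrite /psi in y1 y2.
have c1 : -2 < c by rewrite -(@ltr_pM2r _ (2 * phi - 1)); lra.
have c2 : c < 2 by rewrite -(@ltr_pM2r _ (2 * phi - 1)); lra.
have n1 : -2 < n by rewrite -(ltr_int R).
have n2 : n < 2 by rewrite -(ltr_int R).
have : n = 0 \/ n = 1 \/ n = -1 by move: n1 n2; clear; lia.
have cE : c = n%:~R by []. have ea : a = m%:~R by [].
case=> [|[]] nE; rewrite {}nE in cE *; rewrite {c}cE in x1 x2 y1 y2 c1 c2.
- have m1 : -2 < m by rewrite -(ltr_int R) -ea; lra.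
  have m2 : m < 2 by rewrite -(ltr_int R) -ea; lra.
  have : m = 0 \/ m = 1 \/ m = - 1 by move: m1 m2; clear; lia.
  by case=> [|[]] ->.
- have m1 : -1 < m by rewrite -(ltr_int R) -ea; lra.
  have m2 : m < 2 by rewrite -(ltr_int R) -ea; lra.
  have : m = 0 \/ m = 1 by move: m1 m2; clear; lia.
  by case=> ->.
- have m1 : -2 < m by rewrite -(ltr_int R) -ea; lra.
  have m2 : m < 1 by rewrite -(ltr_int R) -ea; lra.
  have : m = 0 \/ m = - 1 by move: m1 m2; clear; lia.
  by case=> ->.
Qed.
End Descent.

Definition qshort_class f := exists2 g, qconj f g & g = qshort \/ g = qbar qshort.

Lemma double_inj (x y : zphi) : 2 * x = 2 * y -> x = y.
Proof.
case: x y => [a b] [c d] h.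
have h1 := congr1 zre h; have h2 := congr1 zim h.
rewrite !zphiE /= in h1 h2.
by congr ZPhi; lia.
Qed.

(** The traces determine [a0] and [a1] because [Z[phi]] has no 2-torsion. *)
Lemma qint_ext f g : qodd f = false -> qodd g = false -> qtr f = qtr g ->
  qtr_i f = qtr_i g -> qb0 f = qb0 g -> qb1 f = qb1 g -> f = g.
Proof.
case: f g => o a0 a1 b0 b1 [r a0' a1' b0' b1'] /= -> ->.
rewrite /qtr /qtr_i /= /weight_b => x y e0 e1; rewrite {}e0 {}e1 in x y *; congr QInt.
  by apply: double_inj; apply: (addIr (kappa * (b1' - b0'))).
by apply: double_inj; apply: oppr_inj; apply: (addrI (kappa * (b0' + b1'))).
Qed.

Section Reduction.
Variables (R : realFieldType) (phi : R).
Hypothesis phi2 : phi * phi = phi + 1.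
Hypothesis phi_gt0 : 0 < phi.
Let psi := 1 - phi.

(** The bounds on [qtr_i] and on its conjugate leave seven values; those other
    than [phi] and [- phi] contradict [qtr_i_mod5]. *)
Lemma reduced_qtr_i f : qnorm f = 1 -> qodd f = false -> qtr f = kappa ->
  2 * emb phi (qtr_i f * qtr_i f) <= 5 + 6 * phi ->
  qtr_i f = gold \/ qtr_i f = - gold.
Proof.
move=> n1 o x h.
have lb := gold_lb phi2 phi_gt0; have ub := gold_ub phi2 phi_gt0.
have := conj_bound phi2 phi_gt0 n1; rewrite o x /weight_a !mul1r => c.
have {}c : emb psi (qtr_i f * qtr_i f) <= 21 / 10.
  move: c; rewrite [X in X + _]embM ?psi2 // emb_kappa -lerBrDl => /le_trans; apply.
  have : 138 / 100 * (138 / 100) <= (psi + 2) * (psi + 2).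
    by rewrite ler_pM //; rewrite /psi; lra.
  rewrite -/psi; move: (_ * (psi + 2)) => t; lra.
have [k] := qtr_i_mod5 n1 o; rewrite x.
have := small_qtr_i phi2 phi_gt0 h c; rewrite !inE.
case/or4P => [|||/or4P[]] /eqP ->; rewrite !zphiE /=; try (by left); try (by right); lia.
Qed.

Lemma reduced_b f : qnorm f = 1 -> qodd f = false -> qtr f = kappa ->
  qtr_i f = gold \/ qtr_i f = - gold ->
  qb0 f * qb0 f + qb1 f * qb1 f = 1.
Proof.
move=> n1 o x e; have := four_qnorm f; rewrite n1 o x.
have -> : qtr_i f * qtr_i f = gold * gold by case: e => -> //; rewrite mulrNN.
rewrite mulr1 /weight_a /weight_b mul1r; move: (qb0 f * _ + _) => B h.
have h0 := congr1 zre h; have h1 := congr1 zim h.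
rewrite !zphiE /= in h0 h1.
by apply: zphiP => /=; lia.
Qed.

(** A sum of two squares equal to [1] bounds both embeddings of each term, and
    an element of [Z[phi]] with both embeddings in [[-1, 1]] is [0], [1] or
    [-1]. *)
Lemma reduced_unit f : qnorm f = 1 -> qodd f = false -> qtr f = kappa ->
  qtr_i f = gold \/ qtr_i f = - gold ->
  (qb0 f, qb1 f) \in [:: (1, 0); (-1, 0); (0, 1); (0, -1)].
Proof.
move=> n1 o x e; have hB := reduced_b n1 o x e.
have le1 chi : chi * chi = chi + 1 ->
    emb chi (qb0 f * qb0 f) <= 1 /\ emb chi (qb1 f * qb1 f) <= 1 :> R.
  move=> chi2; have := congr1 (emb chi) hB; rewrite embD emb1 => <-.
  by rewrite lerDl lerDr !emb_sqr_ge0.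
have [p0 p1] := le1 _ phi2; have [q0 q1] := le1 _ (psi2 phi2).
have := small_unit phi2 phi_gt0 p0 q0; have := small_unit phi2 phi_gt0 p1 q1.
move: hB; move: (qb0 f) (qb1 f) => b0 b1; rewrite !inE.
by move=> /eqP hB /or3P[] /eqP e1 /or3P[] /eqP e0; move: hB; rewrite e0 e1.
Qed.

(** Traces and [b0, b1] determine the quaternion; each of the eight is conjugate
    by [1], [i], [p^-1] or [p^-1 i] to [qshort] or to its inverse. *)
Lemma reduced_class f : qnorm f = 1 -> qodd f = false -> qtr f = kappa ->
  2 * emb phi (qtr_i f * qtr_i f) <= 5 + 6 * phi -> qshort_class f.
Proof.
move=> n1 o x h.
have e := reduced_qtr_i n1 o x h; have := reduced_unit n1 o x e.
have build a0 a1 b0 b1 : qb0 f = b0 -> qb1 f = b1 ->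
   qtr_i f = kappa * (b0 + b1) - 2 * a1 -> 2 * a0 + kappa * (b1 - b0) = kappa ->
   f = QInt false a0 a1 b0 b1.
  by move=> h0 h1 h2 h3; apply: qint_ext; rewrite // x /qtr /= h3.
have id_ g : g = qshort \/ g = qbar qshort -> qshort_class g.
  by move=> hg; exists g => //; exact: qconj_refl.
have i_ g : qshort_class (conj_i g) -> qshort_class g.
  by case=> g' c' d; exists g' => //; apply: qconj_i.
have pV_ g : qshort_class (conj_pV g) -> qshort_class g.
  by case=> g' c' d; exists g' => //; apply: qconj_pV.
rewrite !inE !xpair_eqE.
move=> /or4P[] /andP[/eqP h0 /eqP h1].
- case: e => e.
    rewrite (build kappa 1 1 0 h0 h1 e erefl); apply: pV_; apply: id_.
    by right.
  rewrite (build kappa (gold * gold) 1 0 h0 h1 e erefl); apply: i_; apply: pV_; apply: id_.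
  by left.
- case: e => e.
    rewrite (build 0 (- (gold * gold)) (-1) 0 h0 h1 e erefl); apply: i_; apply: pV_; apply: id_.
    by right.
  rewrite (build 0 (-1) (-1) 0 h0 h1 e erefl); apply: pV_; apply: id_.
  by left.
- case: e => e.
    by rewrite (build 0 1 0 1 h0 h1 e erefl); apply: id_; left.
  rewrite (build 0 (gold * gold) 0 1 h0 h1 e erefl); apply: i_; apply: id_.
  by right.
- case: e => e.
    rewrite (build kappa (- (gold * gold)) 0 (-1) h0 h1 e erefl); apply: i_; apply: id_.
    by left.
  by rewrite (build kappa (-1) 0 (-1) h0 h1 e erefl); apply: id_; right.
Qed.

Lemma qtr_i_rel f : qnorm f = 1 -> qodd f = false -> qtr f = kappa ->
  emb phi (qtr_i f) * emb phi (qtr_i f) + (1 + 5 * phi) =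
  2 * (1 + 3 * phi) * (emb phi (qb0 f) * emb phi (qb0 f) +
                       emb phi (qb1 f) * emb phi (qb1 f)).
Proof.
move=> n1 o x; have := four_qnorm f; rewrite n1 o x.
rewrite mulr1 /weight_a /weight_b mul1r => h.
rewrite -!embM // -embD; move: (qb0 f * _ + _) h => B h.
have {}h : qtr_i f * qtr_i f + ZPhi 1 5 = ZPhi 2 6 * B.
  move: (qtr_i f * _) h => t h; have h0 := congr1 zre h; have h1 := congr1 zim h.
  by rewrite !zphiE /= in h0 h1; apply: zphiP; rewrite !zphiE /=; lia.
have e1 : emb phi (ZPhi 1 5) = 1 + 5 * phi by rewrite /emb.
have e2 : emb phi (ZPhi 2 6) = 2 * (1 + 3 * phi) by rewrite /emb /=; ring.
by rewrite -e1 -e2 -embM // -embD // h.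
Qed.

(** Conjugation by [p], by [p^-1], and by [p i] or [p^-1 i], realizes the four
    values of [s] in [real_descent]. *)
Lemma descent_step f : qnorm f = 1 -> qodd f = false -> qtr f = kappa ->
  5 + 6 * phi < 2 * emb phi (qtr_i f * qtr_i f) ->
  exists g, [/\ qnorm g = 1, qodd g = false, qtr g = kappa,
    `|emb phi (qtr_i g)| < `|emb phi (qtr_i f)| &
    qshort_class g -> qshort_class f].
Proof.
move=> n1 o x; rewrite embM // => h.
have [s + sY] := real_descent phi2 phi_gt0 (qtr_i_rel n1 o x) h.
have gg : emb phi (gold * gold) = phi + 1 by rewrite embM // emb_gold phi2.
have gk : emb phi (gold * kappa) = 1 + 3 * phi by rewrite /emb /=; ring.
have hE y t : emb phi (gold * gold * y + gold * kappa * t) =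
    (phi + 1) * emb phi y + (1 + 3 * phi) * emb phi t.
  by rewrite embD (embM phi2 (gold * gold)) (embM phi2 (gold * kappa)) gg gk.
have [oi xi_ ei b0i b1i] := conj_i_data o.
have [opi xpi epi] := conj_p_data oi; have [ovi xvi evi] := conj_pV_data oi.
have [op xp ep] := conj_p_data o; have [ov xv ev] := conj_pV_data o.
rewrite !inE => /or4P[] /eqP sE; rewrite {s}sE in sY.
- exists (conj_p (conj_i f)); split.
  + by rewrite qnorm_conj_p qnorm_conj_i.
  + by [].
  + by rewrite xpi xi_.
  + by rewrite epi ei b0i b1i -opprD mulrN opprK hE (embD _ (qb0 f)).
  + by case=> g c d; exists g => //; apply: qconj_i; apply: qconj_p.
- exists (conj_p f); split.
  + by rewrite qnorm_conj_p.
  + by [].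
  + by rewrite xp.
  + by rewrite ep -mulrN hE embN (embD _ (qb0 f)).
  + by case=> g c d; exists g => //; apply: qconj_p.
- exists (conj_pV f); split.
  + by rewrite qnorm_conj_pV.
  + by [].
  + by rewrite xv.
  + by rewrite ev hE (embD _ (qb1 f)) embN.
  + by case=> g c d; exists g => //; apply: qconj_pV.
- exists (conj_pV (conj_i f)); split.
  + by rewrite qnorm_conj_pV qnorm_conj_i.
  + by [].
  + by rewrite xvi xi_.
  + by rewrite evi ei b0i b1i -opprD hE embN (embD _ (qb1 f)) embN.
  + by case=> g c d; exists g => //; apply: qconj_i; apply: qconj_pV.
Qed.

Lemma qtr_i_conj_le f : qnorm f = 1 -> qodd f = false -> `|emb psi (qtr_i f)| <= 2.
Proof.
move=> n1 o; have := conj_bound phi2 phi_gt0 n1; rewrite o /weight_a !mul1r => h.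
rewrite ler_norml; apply/andP; apply: sqr_norm => //.
rewrite -embM ?psi2 //; apply: le_trans (le_trans h _); last lra.
by rewrite lerDr emb_sqr_ge0 ?psi2.
Qed.

(** Each step of the descent diminishes [|qtr_i|] by at least [1 / 4], because
    the conjugate of the difference is at most [4]. *)
Lemma short_trace_class f : qnorm f = 1 -> qodd f = false -> qtr f = kappa ->
  qshort_class f.
Proof.
have bound (z : zphi) : exists n : nat, 4 * `|emb phi z| < n%:R.
  exists (4 * (`|zre z| + 2 * `|zim z|)).+1%N.
  have ub := gold_ub phi2 phi_gt0.
  rewrite -[X in _ < X]natr1 natrM ltr_pwDr // ler_pM2l // natrD natrM.
  apply: le_trans (ler_normD _ _) _; rewrite normrM (gtr0_norm phi_gt0).
  rewrite !natr_absz -!intr_norm lerD // mulrC ler_wpM2r //; lra.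
have [n] := bound (qtr_i f).
elim: n f => [|n IH] f hn n1 o x.
  by move: hn; rewrite ltNge mulr_ge0.
case: (lerP (2 * emb phi (qtr_i f * qtr_i f)) (5 + 6 * phi)) => h.
  exact: reduced_class.
have [g [g1 go gx glt]] := descent_step n1 o x h; apply.
apply: IH => //.
have [sf sfE sfP] : exists2 z, emb phi z = `|emb phi (qtr_i f)| & `|emb psi z| <= 2.
  have c := qtr_i_conj_le n1 o.
  case: (ger0P (emb phi (qtr_i f))) => _; first by exists (qtr_i f).
  by exists (- qtr_i f); rewrite embN // normrN.
have [sg sgE sgP] : exists2 z, emb phi z = `|emb phi (qtr_i g)| & `|emb psi z| <= 2.
  have c := qtr_i_conj_le g1 go.
  case: (ger0P (emb phi (qtr_i g))) => _; first by exists (qtr_i g).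
  by exists (- qtr_i g); rewrite embN // normrN.
have := @emb_gap _ _ phi2 (sf - sg); rewrite !(embD _ sf) !(embN _ sg) sfE sgE subr_gt0.
move=> /(_ glt) gap.
have {}gap : 1 <= 4 * (`|emb phi (qtr_i f)| - `|emb phi (qtr_i g)|).
  apply: gap; apply: le_trans (ler_normB _ _) _.
  by apply: (le_trans (lerD sfP sgP)); lra.
have {}hn : 4 * `|emb phi (qtr_i f)| < n%:R + 1 by rewrite natr1.
by move: hn gap; clear; move: `|_| `|_| n%:R => y z t; lra.
Qed.
End Reduction.

(** * Separation of the two classes modulo 2 *)

(** Modulo the prime above 2 one has [i = 1] and the quaternion order becomes
    the field with sixteen elements, generated over [Z[phi] / 2] by the image
    of [p]; the pair holds the coordinates of the image of the quaternion in
    the basis [1], [p], up to a constant factor on the second one. *)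
Definition residue2 f := (zparity (qa0 f + qa1 f), zparity (qb0 f + qb1 f)).

Lemma zparity_double (x y : zphi) : zparity (x + 2 * y) = zparity x.
Proof.
by rewrite mulr_natl mulr2n /zparity !zphiE !parityD !addbb !addbF.
Qed.

Lemma residue2_conj_i f : qodd f = false -> residue2 (conj_i f) = residue2 f.
Proof.
case: f => o a0 a1 b0 b1 /= ->.
rewrite /residue2 -[X in (X, _) = _](zparity_double _ (kappa * b0)).
rewrite -[X in (_, X) = _](zparity_double _ (b0 + b1)).
by rewrite /conj_i /qbar /qmul_i /weight_b /=; move: kappa => k; congr (zparity _, zparity _); ring.
Qed.
Lemma residue2_conj_p f : qodd f = false -> residue2 (conj_p f) = residue2 f.
Proof.
case: f => o a0 a1 b0 b1 /= ->.
rewrite /residue2 -[X in (X, _) = _](zparity_double _ a1).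
rewrite -[X in (_, X) = _](zparity_double _ b1).
rewrite /conj_p /qbar /qmul_p /weight_a /weight_b /=; move: kappa => k.
by congr (zparity _, zparity _); ring.
Qed.
Lemma residue2_conj_pV f : qodd f = false -> residue2 (conj_pV f) = residue2 f.
Proof.
case: f => o a0 a1 b0 b1 /= ->.
rewrite /residue2 -[X in (X, _) = _](zparity_double _ (a1 - kappa * b1)).
rewrite -[X in (_, X) = _](zparity_double _ (a1 + b1 - kappa * b1)).
rewrite /conj_pV /qbar /qmul_pV /weight_a /weight_b /=; move: kappa => k.
by congr (zparity _, zparity _); ring.
Qed.

Lemma residue2_short : residue2 (qbar qshort) <> residue2 qshort.
Proof. by []. Qed.

(** The quaternion [i p^3]. *)
Definition qlong := qmul_i (qmul_p (qmul_p (qmul_p qone))).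

(** * Realization over the reals *)

(** From here on, [c = cos (pi / 10)] and [s] is the positive square root of
    [2 c^2 - 1 = cos (pi / 5)], so that [phi = 2 s^2] is the golden ratio and
    [2 c = sqrt kappa]. *)
Section Realize.
Variables (R : realFieldType) (c s : R).
Hypothesis c_gt0 : 0 < c.
Hypothesis s_gt0 : 0 < s.
Hypothesis s2 : 2 * (c * c) = 1 + s * s.
Let phi := 2 * (s * s).
Hypothesis phi2 : phi * phi = phi + 1.

Lemma phi_gt0 : 0 < phi.
Proof. by rewrite /phi mulr_gt0 // mulr_gt0. Qed.

Definition root_weight_a (o : bool) := if o then 2 * c else 1.
Definition root_weight_b (o : bool) := if o then 1 else 2 * c.

Definition realize f :=
  let a0 := root_weight_a (qodd f) * emb phi (qa0 f) in
  let a1 := root_weight_a (qodd f) * emb phi (qa1 f) in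
  let b0 := root_weight_b (qodd f) * emb phi (qb0 f) in
  let b1 := root_weight_b (qodd f) * emb phi (qb1 f) in
  Quat (a0 + c * (b1 - b0)) (a1 - c * (b0 + b1)) (s * b0) (- (s * b1)).

Definition unit_i : quat R := Quat 0 1 0 0.

(** The product of the normals [e1 = (0, 1, 0)] and [(s, - c, - c)] of the sides
    [AB] and [BC] of the triangle. *)
Definition unit_p : quat R := Quat (- c) (- c) s 0.

Lemma kappa4 : emb phi kappa = 4 * (c * c).
Proof. by rewrite emb_kappa /phi; have := s2; lra. Qed.
Let s2' : s * s = 2 * (c * c) - 1.
Proof. by rewrite s2 [1 + _]addrC addrK. Qed.

Lemma realize_i f : realize (qmul_i f) = qmul unit_i (realize f).
Proof.
case: f => o a0 a1 b0 b1; rewrite /realize /= !embN.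
by congr Quat; ring.
Qed.

Lemma realize_p f : realize (qmul_p f) = qmul unit_p (realize f).
Proof.
case: f => o a0 a1 b0 b1; rewrite /realize /= !(embD, embN, embM phi2).
case: o; rewrite /weight_a /weight_b /root_weight_a /root_weight_b /= kappa4 emb1;
  by congr Quat; ring: s2'.
Qed.

Lemma realize_pV f : realize (qmul_pV f) = qmul (qconjug unit_p) (realize f).
Proof.
case: f => o a0 a1 b0 b1; rewrite /realize /= !(embD, embN, embM phi2).
case: o; rewrite /weight_a /weight_b /root_weight_a /root_weight_b /= kappa4 emb1;
  by congr Quat; ring: s2'.
Qed.

Lemma realize_bar f : realize (qbar f) = qconjug (realize f).
Proof.
case: f => o a0 a1 b0 b1; rewrite /realize /= !(embD, embN, embM phi2).
by case: o; rewrite /weight_b /root_weight_a /root_weight_b /= ?kappa4 ?emb1; congr Quat; ring.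
Qed.

Lemma realize_one : realize qone = Quat 1 0 0 0.
Proof. by rewrite /realize /= emb0 emb1; congr Quat; ring. Qed.

Lemma realize_norm f : qnormsq (realize f) = emb phi (qnorm f).
Proof.
case: f => o a0 a1 b0 b1; rewrite /realize /qnorm /= !(embD, embN, embM phi2).
by case: o; rewrite /weight_a /weight_b /root_weight_a /root_weight_b /= kappa4 emb1; ring: s2'.
Qed.

Lemma realize_qtr f : 2 * qt0 (realize f) = root_weight_a (qodd f) * emb phi (qtr f).
Proof.
case: f => o a0 a1 b0 b1; rewrite /realize /qtr /= !(embD, embN, embM phi2).
by case: o; rewrite /weight_b /root_weight_a /root_weight_b /= ?kappa4 !emb1; ring.
Qed.

Lemma realize_qtr_i f : 2 * qt1 (realize f) = - (root_weight_a (qodd f) * emb phi (qtr_i f)).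
Proof.
case: f => o a0 a1 b0 b1; rewrite /realize /qtr_i /= !(embD, embN, embM phi2).
by case: o; rewrite /weight_b /root_weight_a /root_weight_b /= ?kappa4 !emb1; ring.
Qed.

Lemma root_weight_aK o : root_weight_a o * root_weight_a o = emb phi (weight_a o).
Proof. by case: o; rewrite /root_weight_a /weight_a ?kappa4 ?emb1; ring. Qed.

Lemma rotm_realize_tr f : qnorm f = 1 ->
  \tr (rotm (realize f)) = emb phi (weight_a (qodd f) * (qtr f * qtr f)) - 1.
Proof.
move=> n1; rewrite rotm_tr ?realize_norm ?n1 ?emb1 //; congr (_ - 1).
rewrite !(embM phi2) -root_weight_aK.
have -> : 4 * (qt0 (realize f) * qt0 (realize f)) =
  2 * qt0 (realize f) * (2 * qt0 (realize f)) by ring.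
by rewrite realize_qtr; ring.
Qed.

Lemma emb_inj : injective (emb phi).
Proof.
move=> x y h; apply/eqP; rewrite -subr_eq0; apply/eqP/znorm_eq0/eqP.
by rewrite -(intr_eq0 R) -(emb_conjM phi2) embD embN h subrr mul0r.
Qed.

(** The antisymmetric part of a rotation matrix, with respect to the Lorentz
    form, is [qt0] times the vector part of the quaternion; equality of the
    traces excludes the opposite quaternion. *)
Lemma rotm_inj f g : qodd f = false -> qodd g = false ->
  qtr f = kappa -> qtr g = kappa -> rotm (realize f) = rotm (realize g) -> f = g.
Proof.
move=> of_ og xf xg.
have e0 : qt0 (realize f) = qt0 (realize g).
  have two : (2 : R) != 0 by rewrite pnatr_eq0.
  by apply: (mulfI two); rewrite !realize_qtr of_ og xf xg.
have t0 : qt0 (realize f) != 0.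
  have : 0 < 2 * qt0 (realize f).
    rewrite realize_qtr of_ xf mul1r emb_kappa; have := phi_gt0; lra.
  by rewrite pmulr_rgt0 // => /lt0r_neq0.
have e1 := realize_qtr_i f; have e1' := realize_qtr_i g.
have r2 h : qt2 (realize h) = s * (root_weight_b (qodd h) * emb phi (qb0 h)) by [].
have r3 h : qt3 (realize h) = - (s * (root_weight_b (qodd h) * emb phi (qb1 h))) by [].
have := r2 f; have := r3 f; have := r2 g; have := r3 g.
rewrite of_ og in e1 e1' *; rewrite /root_weight_a /root_weight_b !mul1r in e1 e1' *.
move: e1 e1' e0 t0; case: (realize f) (realize g) => [h0 h1 h2 h3] [k0 k1 k2 k3] /=.
move=> e1 e1' e0 t0 k3E k2E h3E h2E e.
have m i j := congr1 (fun M : 'M[R]_3 => M i j) e.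
have h4 : 4 * h0 != 0 by rewrite mulf_neq0 // pnatr_eq0.
have e1'' : h1 = k1.
  apply: (mulfI h4); have := m 1 2; have := m 2 1; rewrite !mxE /= -e0; lra.
have e2 : h2 = k2.
  apply: (mulfI h4); have := m 0 1; have := m 1 0; rewrite !mxE /= -e0; lra.
have e3 : h3 = k3.
  apply: (mulfI h4); have := m 0 2; have := m 2 0; rewrite !mxE /= -e0; lra.
have sc : s * (2 * c) != 0 by rewrite mulf_neq0 ?lt0r_neq0 // mulr_gt0.
apply: qint_ext => //; first by rewrite xf xg.
- by apply: emb_inj; apply: oppr_inj; rewrite -e1 -e1' e1''.
- by apply: emb_inj; apply: (mulfI sc); rewrite -!(mulrA s) -h2E -k2E.
- by apply: emb_inj; apply: (mulfI sc); apply: oppr_inj; rewrite -!(mulrA s) -h3E -k3E.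
Qed.

End Realize.

(** * The group of rotations in the frame of the triangle *)
Section RotationGroup.
Variables (R : realFieldType) (c s : R).
Hypothesis c_gt0 : 0 < c.
Hypothesis s_gt0 : 0 < s.
Hypothesis s2 : 2 * (c * c) = 1 + s * s.
Let phi := 2 * (s * s).
Hypothesis phi2 : phi * phi = phi + 1.
Let s2' : s * s = 2 * (c * c) - 1.
Proof. by rewrite s2 [1 + _]addrC addrK. Qed.

(** The reflections in the sides [AB], [CA] and [BC], with normals [(0, 1, 0)],
    [(0, 0, 1)] and [(s, - c, - c)]. *)
Definition refl1 : 'M[R]_3 := mx3 1 0 0 0 (-1) 0 0 0 1.
Definition refl2 : 'M[R]_3 := mx3 1 0 0 0 1 0 0 0 (-1).
Definition refl3 : 'M[R]_3 :=
  mx3 (1 + 2 * (s * s)) (2 * (s * c)) (2 * (s * c))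
      (- (2 * (s * c))) (1 - 2 * (c * c)) (- (2 * (c * c)))
      (- (2 * (s * c))) (- (2 * (c * c))) (1 - 2 * (c * c)).

Definition rot_i : 'M[R]_3 := rotm (unit_i R).
Definition rot_p : 'M[R]_3 := rotm (unit_p c s).
Definition rot_pV : 'M[R]_3 := rotm (qconjug (unit_p c s)).

Lemma refl1K : refl1 * refl1 = 1.
Proof. by rewrite mx3_mul mx3_1; congr mx3; ring. Qed.
Lemma refl2K : refl2 * refl2 = 1.
Proof. by rewrite mx3_mul mx3_1; congr mx3; ring. Qed.
Lemma refl3K : refl3 * refl3 = 1.
Proof. by rewrite mx3_mul mx3_1; congr mx3; ring: s2'. Qed.
Lemma refl12 : refl1 * refl2 = rot_i.
Proof. by rewrite mx3_mul /rot_i /=; congr mx3; ring. Qed.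
Lemma refl21 : refl2 * refl1 = rot_i.
Proof. by rewrite mx3_mul /rot_i /=; congr mx3; ring. Qed.
Lemma refl13 : refl1 * refl3 = rot_p.
Proof. by rewrite mx3_mul /rot_p /=; congr mx3; ring: s2'. Qed.
Lemma refl31 : refl3 * refl1 = rot_pV.
Proof. by rewrite mx3_mul /rot_pV /=; congr mx3; ring: s2'. Qed.

Lemma refl_det : [/\ \det refl1 = -1, \det refl2 = -1 & \det refl3 = -1].
Proof. by split; rewrite mx3_det; ring: s2'. Qed.

Lemma rot_iK : rot_i * rot_i = 1.
Proof. by rewrite -{1}refl12 -refl21 mulrA -[_ * _ * refl2]mulrA refl2K mulr1 refl1K. Qed.
Lemma rot_pK : rot_p * rot_pV = 1.
Proof. by rewrite -refl13 -refl31 mulrA -[_ * _ * refl3]mulrA refl3K mulr1 refl1K. Qed.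
Lemma rot_pVK : rot_pV * rot_p = 1.
Proof. by rewrite -refl13 -refl31 mulrA -[_ * _ * refl1]mulrA refl1K mulr1 refl3K. Qed.

Inductive rotword : 'M[R]_3 -> Prop :=
| rotword_1 : rotword 1
| rotword_i M : rotword M -> rotword (rot_i * M)
| rotword_p M : rotword M -> rotword (rot_p * M)
| rotword_pV M : rotword M -> rotword (rot_pV * M).

Lemma rotword_mul M N : rotword M -> rotword N -> rotword (M * N).
Proof.
move=> hM hN; elim: hM => [|K _ IH|K _ IH|K _ IH]; rewrite ?mul1r //.
- by rewrite -mulrA; apply: rotword_i.
- by rewrite -mulrA; apply: rotword_p.
- by rewrite -mulrA; apply: rotword_pV.
Qed.

Lemma rotword_gen : [/\ rotword rot_i, rotword rot_p & rotword rot_pV].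
Proof.
by split; rewrite -[X in rotword X]mulr1;
  [apply: rotword_i|apply: rotword_p|apply: rotword_pV]; exact: rotword_1.
Qed.

Lemma rotword_inv M : rotword M -> exists N, [/\ rotword N, M * N = 1 & N * M = 1].
Proof.
have [gi gp gV] := rotword_gen.
have step g h K N : g * h = 1 -> h * g = 1 -> K * N = 1 -> N * K = 1 ->
    g * K * (N * h) = 1 /\ N * h * (g * K) = 1 :> 'M[R]_3.
  move=> gh hg KN NK; split.
    by rewrite mulrA -[g * K * N]mulrA KN mulr1.
  by rewrite mulrA -[N * h * g]mulrA hg mulr1.
elim=> [|K _ [N [hN KN NK]]|K _ [N [hN KN NK]]|K _ [N [hN KN NK]]].
- by exists 1; rewrite mulr1; split=> //; exact: rotword_1.
- exists (N * rot_i); have [] := step _ _ _ _ rot_iK rot_iK KN NK.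
  by split=> //; apply: rotword_mul.
- exists (N * rot_pV); have [] := step _ _ _ _ rot_pK rot_pVK KN NK.
  by split=> //; apply: rotword_mul.
- exists (N * rot_p); have [] := step _ _ _ _ rot_pVK rot_pK KN NK.
  by split=> //; apply: rotword_mul.
Qed.

(** Conjugation by the reflection in [AB] fixes [i] and inverts [p], so every
    product of reflections is a rotation word, possibly preceded by [refl1]. *)
Lemma rotword_refl1 M : rotword M -> rotword (refl1 * M * refl1).
Proof.
have step g K : refl1 * (g * K) * refl1 = refl1 * g * refl1 * (refl1 * K * refl1).
  by rewrite !mulrA -[_ * refl1 * refl1]mulrA refl1K mulr1.
have e1 : refl1 * rot_i * refl1 = rot_i.
  by rewrite -{1}refl12 mulrA refl1K mul1r refl21.
have e2 : refl1 * rot_p * refl1 = rot_pV.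
  by rewrite -{1}refl13 mulrA refl1K mul1r refl31.
have e3 : refl1 * rot_pV * refl1 = rot_p.
  by rewrite -{1}refl31 -!mulrA refl1K mulr1 refl13.
elim=> [|K _ IH|K _ IH|K _ IH].
- by rewrite mulr1 refl1K; exact: rotword_1.
- by rewrite step e1; apply: rotword_i.
- by rewrite step e2; apply: rotword_pV.
- by rewrite step e3; apply: rotword_p.
Qed.

Lemma rotword_det M : rotword M -> \det M = 1.
Proof.
have [d1 d2 d3] := refl_det.
have di : \det rot_i = 1 by rewrite -refl12 det_mulmx d1 d2 mulrNN mulr1.
have dp : \det rot_p = 1 by rewrite -refl13 det_mulmx d1 d3 mulrNN mulr1.
have dv : \det rot_pV = 1 by rewrite -refl31 det_mulmx d1 d3 mulrNN mulr1.
elim=> [|K _ IH|K _ IH|K _ IH]; first exact: det1.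
- by rewrite det_mulmx di IH mulr1.
- by rewrite det_mulmx dp IH mulr1.
- by rewrite det_mulmx dv IH mulr1.
Qed.

Definition qrot f : 'M[R]_3 := rotm (realize c s f).

Lemma qrot_i f : qrot (qmul_i f) = rot_i * qrot f.
Proof. by rewrite /qrot realize_i rotm_mul. Qed.
Lemma qrot_p f : qrot (qmul_p f) = rot_p * qrot f.
Proof. by rewrite /qrot realize_p // rotm_mul. Qed.
Lemma qrot_pV f : qrot (qmul_pV f) = rot_pV * qrot f.
Proof. by rewrite /qrot realize_pV // rotm_mul. Qed.
Lemma qrot_one : qrot qone = 1.
Proof. by rewrite /qrot realize_one /= mx3_1; congr mx3; ring. Qed.

Lemma qrot_neg f : qrot (qneg f) = qrot f.
Proof.
case: f => o a0 a1 b0 b1; rewrite /qrot /realize /= !embN.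
by congr mx3; ring.
Qed.

Lemma realize_conj (op : qint -> qint) (k : quat R) :
  (forall f, realize c s (op f) = qmul k (realize c s f)) ->
  forall f, qrot (qbar (op (qbar (op f)))) = rotm k * qrot f * rotm (qconjug k).
Proof.
move=> h f; rewrite /qrot realize_bar // h realize_bar // h.
by rewrite !qconjug_mul !qconjugK !rotm_mul.
Qed.

Lemma qrot_conj_i f : qrot (conj_i f) * rot_i = rot_i * qrot f.
Proof.
rewrite /conj_i (realize_conj (realize_i c s)) -[LHS]mulrA.
have -> : rotm (qconjug (unit_i R)) = rot_i.
  by rewrite /rot_i /=; congr mx3; ring.
by rewrite rot_iK mulr1.
Qed.
Lemma qrot_conj_p f : qrot (conj_p f) * rot_p = rot_p * qrot f.
Proof.
by rewrite /conj_p (realize_conj (realize_p s2 phi2)) -[LHS]mulrA rot_pVK mulr1.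
Qed.
Lemma qrot_conj_pV f : qrot (conj_pV f) * rot_pV = rot_pV * qrot f.
Proof.
rewrite /conj_pV (realize_conj (realize_pV s2 phi2)) qconjugK -[LHS]mulrA.
by rewrite rot_pK mulr1.
Qed.

Lemma rotword_qrot M : rotword M -> exists2 f, qnorm f = 1 & M = qrot f.
Proof.
elim=> [|K _ [f n1 ->]|K _ [f n1 ->]|K _ [f n1 ->]].
- by exists qone; rewrite ?qrot_one.
- by exists (qmul_i f); rewrite ?qnorm_i ?qrot_i.
- by exists (qmul_p f); rewrite ?qnorm_p ?qrot_p.
- by exists (qmul_pV f); rewrite ?qnorm_pV ?qrot_pV.
Qed.

Lemma qconj_rotword f g : qconj f g ->
  exists2 K, rotword K & K * qrot f = qrot g * K.
Proof.
have [gi gp gV] := rotword_gen.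
elim=> {f g} [f|f g _ [K hK e]|f g _ [K hK e]|f g _ [K hK e]].
- by exists 1; rewrite ?mul1r ?mulr1 //; exact: rotword_1.
- exists (K * rot_i); first exact: rotword_mul.
  by rewrite -mulrA -qrot_conj_i mulrA e mulrA.
- exists (K * rot_p); first exact: rotword_mul.
  by rewrite -mulrA -qrot_conj_p mulrA e mulrA.
- exists (K * rot_pV); first exact: rotword_mul.
  by rewrite -mulrA -qrot_conj_pV mulrA e mulrA.
Qed.

Lemma rotword_residue2 K f : rotword K -> qodd f = false ->
  exists g, [/\ qodd g = false, qtr g = qtr f, residue2 g = residue2 f &
    K * qrot f = qrot g * K].
Proof.
move=> + o; elim=> [|M _ [g [og xg cg e]]|M _ [g [og xg cg e]]|M _ [g [og xg cg e]]].
- by exists f; rewrite mul1r mulr1.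
- have [ov x' _ _ _] := conj_i_data og.
  exists (conj_i g); split; rewrite // ?x' ?residue2_conj_i //.
  by rewrite -mulrA e mulrA -qrot_conj_i mulrA.
- have [ov x' _] := conj_p_data og.
  exists (conj_p g); split; rewrite // ?x' ?residue2_conj_p //.
  by rewrite -mulrA e mulrA -qrot_conj_p mulrA.
- have [ov x' _] := conj_pV_data og.
  exists (conj_pV g); split; rewrite // ?x' ?residue2_conj_pV //.
  by rewrite -mulrA e mulrA -qrot_conj_pV mulrA.
Qed.

(** A conjugate of [qshort] has the same trace and the same residue, and
    [qrot] is injective on quaternions of trace [kappa]. *)
Lemma qrot_short_nconj K : rotword K -> K * qrot qshort <> qrot (qbar qshort) * K.
Proof.
move=> hK; have [g [og xg cg ->]] := rotword_residue2 hK (erefl : qodd qshort = false).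
have [N [_ KN _]] := rotword_inv hK => /(congr1 (fun M => M * N)).
rewrite -!mulrA KN !mulr1 => e.
have h : g = qbar qshort by apply: (rotm_inj c_gt0 s_gt0 s2 phi2 og _ xg _ e).
by move: cg; rewrite h; apply: residue2_short.
Qed.

(** The trace of [q] is made positive by passing to [- q], which gives the same
    rotation. *)
Lemma rotword_short_class M : rotword M -> 3 < \tr M -> \tr M < 6 + 11 * phi ->
  exists2 K, rotword K &
    K * M = qrot qshort * K \/ K * M = qrot (qbar qshort) * K.
Proof.
have p0 := phi_gt0 s_gt0.
move=> /rotword_qrot[f n1 ->]; rewrite rotm_realize_tr // => h1 h2.
have [of_ x] : qodd f = false /\ (qtr f = kappa \/ qtr f = - kappa).
  by apply: (short_trace phi2 p0 n1); rewrite -/phi in h1 h2 *; lra.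
have {x} [g [gn go gx ->]] : exists g,
    [/\ qnorm g = 1, qodd g = false, qtr g = kappa & qrot f = qrot g].
  case: x => x; first by exists f.
  exists (qneg f); rewrite qnorm_neg qrot_neg; split=> //.
  have -> : qtr (qneg f) = - qtr f by rewrite /qtr /=; ring.
  by rewrite x.
have [h /qconj_rotword[K hK e] hE] := short_trace_class phi2 p0 gn go gx.
by exists K => //; rewrite e; case: hE => ->; [left|right].
Qed.

Lemma rotword_short : rotword (qrot qshort).
Proof.
have [gi gp gV] := rotword_gen.
rewrite -qrot_neg (_ : qneg qshort = qmul_i (qmul_p (qmul_p qone))) //.
rewrite qrot_i !qrot_p qrot_one mulr1.
by do !apply: rotword_mul.
Qed.

Lemma rotword_short_bar : rotword (qrot (qbar qshort)).
Proof.
have [gi gp gV] := rotword_gen.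
rewrite (_ : qbar qshort = qmul_pV (qmul_pV (qmul_i qone))) //.
rewrite !qrot_pV qrot_i qrot_one mulr1.
by do !apply: rotword_mul.
Qed.

Lemma rotword_long : rotword (qrot qlong).
Proof.
have [gi gp gV] := rotword_gen.
rewrite /qlong qrot_i !qrot_p qrot_one mulr1.
by do !apply: rotword_mul.
Qed.

Lemma tr_short : \tr (qrot qshort) = 4 + 5 * phi.
Proof.
rewrite /qrot rotm_realize_tr //.
have -> : weight_a (qodd qshort) * (qtr qshort * qtr qshort) = ZPhi 5 5 by [].
by rewrite -/phi (_ : emb phi (ZPhi 5 5) = 5 + 5 * phi) //; ring.
Qed.
Lemma tr_short_bar : \tr (qrot (qbar qshort)) = 4 + 5 * phi.
Proof.
rewrite /qrot rotm_realize_tr //.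
have -> : weight_a (qodd (qbar qshort)) * (qtr (qbar qshort) * qtr (qbar qshort)) = ZPhi 5 5.
  by [].
by rewrite -/phi (_ : emb phi (ZPhi 5 5) = 5 + 5 * phi) //; ring.
Qed.
Lemma tr_long : \tr (qrot qlong) = 6 + 11 * phi.
Proof.
rewrite /qrot rotm_realize_tr //.
have -> : weight_a (qodd qlong) * (qtr qlong * qtr qlong) = ZPhi 7 11 by [].
by rewrite -/phi (_ : emb phi (ZPhi 7 11) = 7 + 11 * phi) //; ring.
Qed.

End RotationGroup.

(** * Isometries of the hyperboloid *)
Section Lorentz.
Variable R : realType.
Implicit Types (x y z n : 'cV[R]_3) (g : 'M[R]_3).

Lemma lorentz_mx3 : lorentz_mx R = mx3 (-1) 0 0 0 1 0 0 0 1.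
Proof. by apply/matrixP; elim/ord3_ind; elim/ord3_ind; rewrite !mxE /= ?mulr1n ?mulr0n. Qed.

Lemma lorentzE x y :
  lorentz x y = - (x 0 0 * y 0 0) + x 1 0 * y 1 0 + x 2 0 * y 2 0.
Proof.
by rewrite /lorentz lorentz_mx3 !mxE big_ord3 !mxE !big_ord3 !mxE /=; ring.
Qed.

Lemma lorentzC x y : lorentz x y = lorentz y x.
Proof. by rewrite !lorentzE; ring. Qed.
Lemma lorentzDl x y z : lorentz (x + y) z = lorentz x z + lorentz y z.
Proof. by rewrite !lorentzE !mxE; ring. Qed.
Lemma lorentzZl a x y : lorentz (a *: x) y = a * lorentz x y.
Proof. by rewrite !lorentzE !mxE; ring. Qed.
Lemma lorentzDr x y z : lorentz z (x + y) = lorentz z x + lorentz z y.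
Proof. by rewrite !lorentzE !mxE; ring. Qed.
Lemma lorentzZr a x y : lorentz x (a *: y) = a * lorentz x y.
Proof. by rewrite !lorentzE !mxE; ring. Qed.
Definition lorentzL := (lorentzDl, lorentzZl, lorentzDr, lorentzZr).

Lemma cV3P x y : x 0 0 = y 0 0 -> x 1 0 = y 1 0 -> x 2 0 = y 2 0 -> x = y.
Proof.
by move=> h0 h1 h2; apply/colP; elim/ord3_ind.
Qed.

(** The reversed Cauchy-Schwarz inequality; the difference of the squares of
    [x0 y0] and [1 + x1 y1 + x2 y2] is a sum of three squares. *)
Lemma hplane_lorentz x y : hplane x -> hplane y -> lorentz x y <= -1.
Proof.
move=> [+ x0] [+ y0]; rewrite !lorentzE.
move: (x 0 0) (x 1 0) (x 2 0) (y 0 0) (y 1 0) (y 2 0) x0 y0.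
move=> a b c d e f a0 d0 h1 h2.
rewrite leNgt; apply/negP => h0.
have h : a * d < 1 + (b * e + c * f) by lra.
move: h0 => _.
have : a * d * (a * d) < (1 + (b * e + c * f)) * (1 + (b * e + c * f)).
  have p : 0 < a * d by rewrite mulr_gt0.
  by rewrite ltr_pM // ltW.
apply/negP; rewrite -leNgt.
have -> : a * d * (a * d) = (1 + b * b + c * c) * (1 + e * e + f * f).
  have -> : a * d * (a * d) = (a * a) * (d * d) by ring.
  by congr (_ * _); lra.
rewrite -subr_ge0.
have -> : (1 + b * b + c * c) * (1 + e * e + f * f)
   - (1 + (b * e + c * f)) * (1 + (b * e + c * f)) =
   (b - e) ^+ 2 + (c - f) ^+ 2 + (b * f - c * e) ^+ 2 by ring.
by rewrite !addr_ge0 ?sqr_ge0.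
Qed.

Definition isometry g := forall x y, lorentz (g *m x) (g *m y) = lorentz x y.
Definition forward g := forall x, hplane x -> hplane (g *m x).

Lemma isometry_mx g : isometry g <-> g^T *m lorentz_mx R *m g = lorentz_mx R.
Proof.
split=> [h|h x y]; last first.
  by rewrite /lorentz trmx_mul -[in RHS]h !mulmxA.
apply/matrixP => i j; have e1 k : g *m delta_mx k 0 = col k g :> 'cV_3 by rewrite colE.
have ent (M : 'M[R]_3) : M i j = ((delta_mx i 0 : 'cV_3)^T *m M *m (delta_mx j 0 : 'cV_3)) 0 0.
  by rewrite -mulmxA -colE trmx_delta -rowE !mxE.
have := h (delta_mx i 0) (delta_mx j 0); rewrite /lorentz trmx_mul => e.
by rewrite (ent (g^T *m _ *m g)) (ent (lorentz_mx R)) -e !mulmxA.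
Qed.

Definition inv_iso g := lorentz_mx R *m g^T *m lorentz_mx R.

Lemma lorentz_mxK : lorentz_mx R *m lorentz_mx R = 1.
Proof. by rewrite lorentz_mx3 mx3_1 [LHS]mx3_mul; congr mx3; ring. Qed.

Lemma inv_isoK g : isometry g -> inv_iso g *m g = 1 /\ g *m inv_iso g = 1.
Proof.
move=> /isometry_mx h; have e : inv_iso g *m g = 1.
  by rewrite /inv_iso -!mulmxA [g^T *m _]mulmxA h lorentz_mxK.
by split=> //; apply: mulmx1C.
Qed.

Lemma isometry_unit g : isometry g -> g \in unitmx.
Proof. by case/inv_isoK => _ /mulmx1_unit[]. Qed.

Lemma isometry_mul g h : isometry g -> isometry h -> isometry (g *m h).
Proof. by move=> gi hi x y; rewrite -!mulmxA gi hi. Qed.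
Lemma isometry_invmx g : isometry g -> isometry (invmx g).
Proof.
move=> gi x y; have u := isometry_unit gi.
by rewrite -gi !mulmxA !mulmxV // !mul1mx.
Qed.
Lemma isometry_1 : isometry 1.
Proof. by move=> x y; rewrite !mul1mx. Qed.

Lemma hrefl_mulE n x : hrefl n *m x = x + (- (2 * lorentz n x)) *: n.
Proof.
rewrite [in RHS]scaleNr.
rewrite /hrefl mulmxBl mul1mx -scalemxAl -scalerA; congr (_ - _ *: _).
rewrite -!mulmxA; have -> : n^T *m (lorentz_mx R *m x) = (lorentz n x)%:M.
  by rewrite mulmxA [LHS]mx11_scalar.
by rewrite mul_mx_scalar.
Qed.

Lemma hrefl_isometry n : lorentz n n = 1 -> isometry (hrefl n).
Proof.
move=> n1 x y; rewrite !hrefl_mulE !lorentzL n1 (lorentzC x n); ring.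
Qed.

Lemma hplane_sign x : lorentz x x = -1 -> hplane x \/ hplane (- x).
Proof.
move=> h; case: (ltrgtP (x 0 0) 0) => x0; last first.
- have := h; rewrite lorentzE x0 mulr0 oppr0 add0r => e.
  have : 0 <= x 1 0 * x 1 0 + x 2 0 * x 2 0 by rewrite -!expr2 addr_ge0 ?sqr_ge0.
  by rewrite e; lra.
- by left.
- right; split; last by rewrite mxE oppr_gt0.
  by rewrite -scaleN1r !lorentzL mulrA mulrNN !mul1r.
Qed.

(** Otherwise the image of [x] would be the opposite of a point of the upper
    sheet, and its product with [x] would be at least [1], whereas it equals
    [-1 - 2 <n, x>^2]. *)
Lemma hrefl_forward n : lorentz n n = 1 -> forward (hrefl n).
Proof.
move=> n1 x hx; have := hrefl_isometry n1 x x; rewrite (proj1 hx) => h.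
case: (hplane_sign h) => // hN.
have := hplane_lorentz hx hN; rewrite -scaleN1r lorentzZr hrefl_mulE.
rewrite !lorentzL (proj1 hx) (lorentzC x n) => e.
have : 0 <= lorentz n x * lorentz n x by rewrite -expr2 sqr_ge0.
by move: (lorentz n x) e => t e; lra.
Qed.

Lemma hrefl_mx3 n : hrefl n =
  mx3 (1 + 2 * (n 0 0 * n 0 0)) (- (2 * (n 0 0 * n 1 0))) (- (2 * (n 0 0 * n 2 0)))
      (2 * (n 0 0 * n 1 0)) (1 - 2 * (n 1 0 * n 1 0)) (- (2 * (n 1 0 * n 2 0)))
      (2 * (n 0 0 * n 2 0)) (- (2 * (n 1 0 * n 2 0))) (1 - 2 * (n 2 0 * n 2 0)).
Proof.
rewrite /hrefl lorentz_mx3.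
by apply/matrixP; elim/ord3_ind; elim/ord3_ind;
  rewrite !mxE big_ord3 !mxE !big_ord_recl !big_ord0 !mxE /= ?mulr1n ?mulr0n; ring.
Qed.

Lemma hrefl_conj F n : isometry F -> hrefl (F *m n) = F *m hrefl n *m invmx F.
Proof.
move=> Fi; have u := isometry_unit Fi; apply: (can_inj (mulmxK u)).
rewrite mulmxKV // /hrefl mulmxBl mul1mx mulmxBr mulmx1; congr (_ - _).
rewrite -scalemxAl -scalemxAr trmx_mul; congr (_ *: _).
by rewrite -!mulmxA [F^T *m _]mulmxA (isometry_mx F).1.
Qed.

End Lorentz.

(** * Length and trace of hyperbolic isometries *)
Section Arccosh.
Variable R : realType.

Lemma arccosh_ltr (t u : R) : 1 <= t -> t < u -> arccosh t < arccosh u.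
Proof.
move=> t1 tu; have t0 : 0 < t by lra. have u0 : 0 < u by lra.
rewrite /arccosh ltr_ln ?posrE; last 2 first.
- by rewrite ltr_pwDl ?sqrtr_ge0.
- by rewrite ltr_pwDl ?sqrtr_ge0.
by rewrite ltr_leD // ler_wsqrtr // lerB // ler_sqr ?nnegrE ltW.
Qed.

Lemma arccosh_ler (t u : R) : 1 <= t -> t <= u -> arccosh t <= arccosh u.
Proof.
by move=> t1; rewrite le_eqVlt => /orP[/eqP->//|/(arccosh_ltr t1)/ltW].
Qed.

Lemma arccosh_double (t : R) : 1 <= t -> arccosh (2 * t ^+ 2 - 1) = 2 * arccosh t.
Proof.
move=> t1; have t0 : 0 <= t by lra.
have t2 : 0 <= t ^+ 2 - 1 by rewrite subr_ge0 expr_ge1.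
have -> : 2 * arccosh t = arccosh t + arccosh t by ring.
rewrite /arccosh -lnM ?posrE; last 2 first.
- by rewrite ltr_pwDl ?sqrtr_ge0 //; lra.
- by rewrite ltr_pwDl ?sqrtr_ge0 //; lra.
congr ln.
have -> : (2 * t ^+ 2 - 1) ^+ 2 - 1 = (2 * t) ^+ 2 * (t ^+ 2 - 1) by ring.
rewrite sqrtrM ?sqr_ge0 // sqrtr_sqr ger0_norm; last by rewrite mulr_ge0.
have e := sqr_sqrtr t2; rewrite expr2 in e.
move: (Num.sqrt _) e => q e.
by ring: e.
Qed.
End Arccosh.

Section HyperbolicElements.
Variable R : realType.
Implicit Types (x y z n p : 'cV[R]_3) (g : 'M[R]_3).

Lemma ideal_lorentz x y : ideal_points x -> ideal_points y -> x <> y ->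
  lorentz x y < 0.
Proof.
move=> [+ x0] [+ y0]; rewrite !lorentzE x0 y0 => hx hy xy.
rewrite ltNge; apply/negP => h.
have e : (x 1 0 - y 1 0) ^+ 2 + (x 2 0 - y 2 0) ^+ 2 <= 0 by lra.
have : (x 1 0 - y 1 0) ^+ 2 + (x 2 0 - y 2 0) ^+ 2 == 0.
  by rewrite eq_le e addr_ge0 ?sqr_ge0.
rewrite paddr_eq0 ?sqr_ge0 // !sqrf_eq0 !subr_eq0 => /andP[/eqP e1 /eqP e2].
by apply: xy; apply: cV3P; rewrite // x0 y0.
Qed.

Definition has_axis g (a : R) x y :=
  [/\ 0 < a, ideal_points x /\ ideal_points y, x <> y,
      g *m x = a *: x & g *m y = a^-1 *: y].

(** The Lorentz cross product: [lorentz (lorentz_cross x y) z] is the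
    determinant of [x, y, z]. *)
Definition lorentz_cross x y : 'cV[R]_3 := \col_i nth 0
  [:: - (x 1 0 * y 2 0 - x 2 0 * y 1 0); x 2 0 * y 0 0 - x 0 0 * y 2 0;
      x 0 0 * y 1 0 - x 1 0 * y 0 0] i.

(** Two ideal points and the unit vector orthogonal to both form a basis adapted
    to the axis that joins these points. *)
Lemma axis_basis x y : ideal_points x -> ideal_points y -> x <> y ->
  exists v, [/\ lorentz v v = 1, lorentz v x = 0, lorentz v y = 0,
    (forall p, p = (lorentz p y / lorentz x y) *: x
                  + (lorentz p x / lorentz x y) *: y + lorentz p v *: v) &
    exists2 Q : 'M[R]_3, Q \in unitmx &
      forall g a b d, g *m x = a *: x -> g *m y = b *: y -> g *m v = d *: v ->
        g *m Q = Q *m mx3 a 0 0 0 b 0 0 0 d].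
Proof.
move=> hx hy xy; have w0 := ideal_lorentz hx hy xy.
set w := lorentz x y in w0 *.
have wn0 : w != 0 by rewrite ltr0_neq0.
pose v := w^-1 *: lorentz_cross x y.
have cx z : lorentz (lorentz_cross x y) z =
    (x 1 0 * y 2 0 - x 2 0 * y 1 0) * z 0 0 + (x 2 0 * y 0 0 - x 0 0 * y 2 0) * z 1 0
    + (x 0 0 * y 1 0 - x 1 0 * y 0 0) * z 2 0.
  by rewrite lorentzE !mxE /=; ring.
have vx : lorentz v x = 0 by rewrite lorentzZl cx; ring.
have vy : lorentz v y = 0 by rewrite lorentzZl cx; ring.
have vv : lorentz v v = 1.
  rewrite !lorentzL cx !mxE /=.
  have := proj1 hx; have := proj1 hy; rewrite !lorentzE => ey ex.
  have -> : (x 1 0 * y 2 0 - x 2 0 * y 1 0) * - (x 1 0 * y 2 0 - x 2 0 * y 1 0)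
   + (x 2 0 * y 0 0 - x 0 0 * y 2 0) * (x 2 0 * y 0 0 - x 0 0 * y 2 0)
   + (x 0 0 * y 1 0 - x 1 0 * y 0 0) * (x 0 0 * y 1 0 - x 1 0 * y 0 0) = w * w.
    apply/eqP; rewrite -subr_eq0 /w lorentzE; apply/eqP.
    transitivity (- ((- (x 0 0 * x 0 0) + x 1 0 * x 1 0 + x 2 0 * x 2 0) *
       (- (y 0 0 * y 0 0) + y 1 0 * y 1 0 + y 2 0 * y 2 0))); first by ring.
    by rewrite ex mul0r oppr0.
  by field; rewrite wn0.
clearbody v.
pose Q : 'M[R]_3 := mx3 (x 0 0) (y 0 0) (v 0 0) (x 1 0) (y 1 0) (v 1 0)
                        (x 2 0) (y 2 0) (v 2 0).
have Qe a b d : Q *m (\col_i nth 0 [:: a; b; d] i) = a *: x + b *: y + d *: v.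
  by apply: cV3P; rewrite !mxE big_ord3 !mxE /=; ring.
have gram : Q^T *m lorentz_mx R *m Q = mx3 0 w 0 w 0 0 0 0 1.
  have ent i j : (Q^T *m lorentz_mx R *m Q) i j = lorentz (col i Q) (col j Q).
    by rewrite lorentz_mx3 lorentzE !mxE big_ord3 !mxE !big_ord3 !mxE /=; ring.
  have c0 : col 0 Q = x by apply: cV3P; rewrite !mxE.
  have c1 : col 1 Q = y by apply: cV3P; rewrite !mxE.
  have c2 : col 2 Q = v by apply: cV3P; rewrite !mxE.
  apply/matrixP; elim/ord3_ind; elim/ord3_ind; rewrite ent ?c0 ?c1 ?c2 mxE /=;
    rewrite ?(proj1 hx) ?(proj1 hy) ?vx ?vy ?vv // 1?lorentzC ?vx ?vy //.
have Qu : Q \in unitmx.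
  have := congr1 determinant gram; rewrite det_mulmx [X in _ = X]mx3_det => h.
  rewrite unitmxE unitfE; apply: contraTneq isT => d0; move: h; rewrite d0 mulr0.
  move/esym/eqP.
  have -> : 0 * (0 * 1 - 0 * 0) - w * (w * 1 - 0 * 0) + 0 * (w * 0 - 0 * 0) = - (w * w).
    by ring.
  by rewrite oppr_eq0 mulf_eq0 (negbTE wn0).
exists v; split=> //.
  move=> p; set q := _ + _; apply/eqP; rewrite -subr_eq0; apply/eqP.
  have Ju : Q^T *m lorentz_mx R \in unitmx.
    rewrite unitmx_mul unitmx_tr Qu /=.
    by have [] := mulmx1_unit (lorentz_mxK R).
  suff h : Q^T *m lorentz_mx R *m (p - q) = 0.
    by rewrite -[LHS](mulKmx Ju) h mulmx0.
  have ent z : Q^T *m lorentz_mx R *m z = \col_i nth 0 [:: lorentz x z; lorentz y z; lorentz v z] i.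
    by apply: cV3P; rewrite lorentz_mx3 !mxE big_ord3 !mxE !big_ord3 !mxE /= lorentzE; ring.
  rewrite ent -scaleN1r; apply: cV3P; rewrite !mxE /= /q !lorentzL.
  - rewrite (proj1 hx) (lorentzC x v) vx (lorentzC p x) -/w; field.
    by rewrite wn0.
  - rewrite (proj1 hy) (lorentzC y v) vy (lorentzC p y) (lorentzC y x) -/w; field.
    by rewrite wn0.
  - by rewrite vx vy vv (lorentzC p v); ring.
exists Q => // g a b d gx gy gv.
have cols (M N : 'M[R]_3) : (forall j, col j M = col j N) -> M = N.
  by move=> h; apply/matrixP => i j; have := congr1 (fun c : 'cV_3 => c i 0) (h j); rewrite !mxE.
have c0 : col 0 Q = x by apply: cV3P; rewrite !mxE.
have c1 : col 1 Q = y by apply: cV3P; rewrite !mxE.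
have c2 : col 2 Q = v by apply: cV3P; rewrite !mxE.
apply: cols; elim/ord3_ind; rewrite [LHS]colE -mulmxA -colE ?c0 ?c1 ?c2 ?gx ?gy ?gv;
  by apply: cV3P; rewrite !mxE big_ord3 !mxE /=; ring.
Qed.
End HyperbolicElements.

Section AxisElements.
Variable R : realType.
Implicit Types (x y z n p : 'cV[R]_3) (g : 'M[R]_3).

Lemma timelike_scaling (w : R) : w < 0 -> exists2 k : R, 0 < k & 2 * (k * k * w) = -1.
Proof.
move=> w0; have w2 : 0 < - (2 * w) by lra.
have q0 : 0 < Num.sqrt (- (2 * w)) by rewrite sqrtr_gt0.
exists (Num.sqrt (- (2 * w)))^-1; first by rewrite invr_gt0.
have /(congr1 (fun t => - t)) := sqr_sqrtr (ltW w2); rewrite opprK => e.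
have -> : forall k, 2 * (k * k * w) = k ^+ 2 * (2 * w) by move=> k; ring.
by move: (Num.sqrt _) q0 e => q q0 <-; field; rewrite lt0r_neq0.
Qed.

(** The pole of the axis is an eigenvector, whose eigenvalue is [1] because the
    eigenvalues at the ends are inverse to each other and the determinant is
    [1]. *)
Lemma axis_decomp g a x y : isometry g -> \det g = 1 -> 0 < a ->
  ideal_points x -> ideal_points y -> x <> y ->
  g *m x = a *: x -> g *m y = a^-1 *: y ->
  [/\ \tr g = 1 + a + a^-1, a = 1 -> g = 1 &
    exists v, [/\ lorentz v v = 1, lorentz v x = 0, lorentz v y = 0, g *m v = v &
      forall p, p = (lorentz p y / lorentz x y) *: x
                  + (lorentz p x / lorentz x y) *: y + lorentz p v *: v]].
Proof.
move=> gi gd a0 hx hy xy gx gy.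
have an0 : a != 0 by rewrite lt0r_neq0.
have [v [vv vx vy dec [Q Qu Qg]]] := axis_basis hx hy xy.
have gvx : lorentz (g *m v) x = 0.
  by apply: (mulfI an0); rewrite -lorentzZr -gx gi vx mulr0.
have gvy : lorentz (g *m v) y = 0.
  by apply: (mulfI (invr_neq0 an0)); rewrite -lorentzZr -gy gi vy mulr0.
have gv : g *m v = lorentz (g *m v) v *: v.
  by rewrite [LHS]dec gvx gvy !mul0r !scale0r !add0r.
move: (lorentz (g *m v) v) gv => d gv; have e := Qg _ _ _ _ gx gy gv.
have dQ : \det Q != 0 by rewrite -unitfE -unitmxE.
have d1 : d = 1.
  have := congr1 determinant e; rewrite !det_mulmx gd mx3_det mul1r.
  rewrite -[X in X = _]mulr1 => /(mulfI dQ) ->.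
  by field.
have tg : \tr g = 1 + a + a^-1.
  have -> : g = Q *m mx3 a 0 0 0 a^-1 0 0 0 d *m invmx Q by rewrite -e mulmxK.
  by rewrite mxtrace_mulC mulKmx // mx3_tr d1; ring.
rewrite {}d1 scale1r in gv e; split=> //; last by exists v.
move=> a1; move: e; rewrite a1 invr1 -mx3_1 mulmx1 => e.
by rewrite -[g](mulmxK Qu) e mulmxV.
Qed.

Lemma forward_axis_gt0 g a x y : forward g -> ideal_points x -> ideal_points y ->
  x <> y -> a != 0 -> g *m x = a *: x -> g *m y = a^-1 *: y -> 0 < a.
Proof.
move=> gf hx hy xy an0 gx gy; have w0 := ideal_lorentz hx hy xy.
have [k k0 k2] := timelike_scaling w0.
have hp : hplane (k *: (x + y)).
  split; last by rewrite !mxE (proj2 hx) (proj2 hy) mulr_gt0 // addr_gt0.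
  rewrite !lorentzL (proj1 hx) (proj1 hy) (lorentzC y x) -k2; ring.
have [_] := gf _ hp; rewrite -scalemxAr mulmxDr gx gy !mxE (proj2 hx) (proj2 hy).
rewrite !mulr1 pmulr_rgt0 // => h.
case: (ltrgtP a 0) an0 => // an _.
have : a^-1 < 0 by rewrite invr_lt0.
lra.
Qed.

(** The product [lorentz x y] is preserved and nonzero, so the eigenvalues are
    inverse to each other.  If they were [1], then [g] would be the identity
    and fix more than two ideal points. *)
Lemma hyperbolic_axis g : isometry g -> forward g -> \det g = 1 ->
  hyperbolic g -> exists a x y, has_axis g a x y /\ a <> 1.
Proof.
move=> gi gf gd [x [y [xy e]]].
have mem z : (ideal_points z /\ fixes_ideal g z) <-> (z = x \/ z = y).
  have := congr1 (fun S : set 'cV[R]_3 => S z) e; rewrite /= => ->.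
  by split=> [[->|->]|[->|->]]; [left|right|left|right].
have [hx [a gx]] := (mem x).2 (or_introl erefl).
have [hy [b gy]] := (mem y).2 (or_intror erefl).
have w0 := ideal_lorentz hx hy xy.
have ab : a * b = 1.
  apply: (mulIf (ltr0_neq0 w0)); rewrite mul1r -[RHS]gi gx gy !lorentzL; ring.
have an0 : a != 0.
  apply: contraTneq isT => a0; move: ab.
  by rewrite a0 mul0r => /esym/eqP; rewrite oner_eq0.
have bE : b = a^-1 by apply: (mulfI an0); rewrite ab divff.
rewrite {}bE in gy ab; have a0 := forward_axis_gt0 gf hx hy xy an0 gx gy.
exists a, x, y; split=> // a1.
have [_ /(_ a1) g1 _] := axis_decomp gi gd a0 hx hy xy gx gy.
have fixd z : ideal_points z -> z = x \/ z = y.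
  move=> hz; apply: (mem z).1; split=> //; exists 1.
  by rewrite g1 mul1mx scale1r.
pose pt (t u : R) : 'cV[R]_3 := \col_i nth 0 [:: 1; t; u] i.
have idl t u : t * t + u * u = 1 -> ideal_points (pt t u).
  move=> h; split; last by rewrite mxE.
  rewrite lorentzE !mxE /= -addrA h; ring.
have i1 : ideal_points (pt 1 0) by apply: idl; ring.
have i2 : ideal_points (pt (-1) 0) by apply: idl; ring.
have i3 : ideal_points (pt 0 1) by apply: idl; ring.
have neq (p q : 'cV[R]_3) i : p i 0 != q i 0 -> p <> q by move=> + pq; rewrite pq eqxx.
have n12 : pt 1 0 <> pt (-1) 0.
  by apply: (neq _ _ 1); rewrite !mxE /= -subr_eq0 opprK (_ : 1 + 1 = 2%:R) // pnatr_eq0.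
have n13 : pt 1 0 <> pt 0 1 by apply: (neq _ _ 1); rewrite !mxE /= oner_eq0.
have n23 : pt (-1) 0 <> pt 0 1.
  by apply: (neq _ _ 1); rewrite !mxE /= oppr_eq0 oner_eq0.
by case: (fixd _ i1) (fixd _ i2) (fixd _ i3) n12 n13 n23 => -> [] -> [] ->.
Qed.

Lemma axis_hyperbolic g a x y : isometry g -> has_axis g a x y -> a <> 1 -> hyperbolic g.
Proof.
move=> gi [a0 [hx hy] xy gx gy] a1; exists x, y; split=> //.
have an0 : a != 0 by rewrite lt0r_neq0.
apply/seteqP; split=> z /=; last first.
  by case=> ->; split=> //; [exists a|exists a^-1].
move=> [hz [b gz]].
case: (pselect (z = x)) => [->|zx]; first by left.
case: (pselect (z = y)) => [->|zy]; first by right.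
have wx := ltr0_neq0 (ideal_lorentz hz hx zx).
have wy := ltr0_neq0 (ideal_lorentz hz hy zy).
have h1 : b * a = 1.
  by apply: (mulIf wx); rewrite mul1r -[RHS]gi gz gx !lorentzL; ring.
have h2 : b * a^-1 = 1.
  by apply: (mulIf wy); rewrite mul1r -[RHS]gi gz gy !lorentzL; ring.
case: a1; have ba : b = a by rewrite -[LHS]mulr1 -(mulVf an0) mulrA h2 mul1r.
rewrite ba in h1; have : (a - 1) * (a + 1) = 0 by rewrite mulrBl !mulrDr h1; ring.
move/eqP; rewrite mulf_eq0 => /orP[|]; first by rewrite subr_eq0 => /eqP.
by move=> h; have := lt0r_neq0 (_ : 0 < a + 1); rewrite h addr_gt0 // => /(_ isT).
Qed.

Lemma addV_ge2 (a : R) : 0 < a -> 2 <= a + a^-1.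
Proof.
move=> a0; rewrite -subr_ge0.
have -> : a + a^-1 - 2 = (a - 1) ^+ 2 / a by field; rewrite lt0r_neq0.
by rewrite divr_ge0 ?sqr_ge0 // ltW.
Qed.

Lemma addV_gt2 (a : R) : 0 < a -> a <> 1 -> 2 < a + a^-1.
Proof.
move=> a0 a1; rewrite -subr_gt0.
have -> : a + a^-1 - 2 = (a - 1) ^+ 2 / a by field; rewrite lt0r_neq0.
by rewrite divr_gt0 // lt0r sqr_ge0 andbT sqrf_eq0 subr_eq0; apply/eqP.
Qed.

(** For a point [p] whose component along the pole of the axis is [d], the product
    [- lorentz p (g p)] is [(1 + d^2) (a + a^-1) / 2 - d^2], which is least on
    the axis, where [d = 0]. *)
Lemma axis_hlength g a x y : isometry g -> forward g -> \det g = 1 -> has_axis g a x y ->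
  hlength g = arccosh ((a + a^-1) / 2).
Proof.
move=> gi gf gd [a0 [hx hy] xy gx gy]; have w0 := ideal_lorentz hx hy xy.
have an0 : a != 0 by rewrite lt0r_neq0.
have a2 := addV_ge2 a0.
have [_ _ [v [vv vx vy gv dec]]] := axis_decomp gi gd a0 hx hy xy gx gy.
have val al be de : lorentz (al *: x + be *: y + de *: v) (g *m (al *: x + be *: y + de *: v))
   = al * be * lorentz x y * (a + a^-1) + de * de.
  rewrite !mulmxDr -!scalemxAr gx gy gv !lorentzL (proj1 hx) (proj1 hy) vx vy vv.
  by rewrite (lorentzC x v) (lorentzC y v) vx vy (lorentzC y x); ring.
have nrm al be de : lorentz (al *: x + be *: y + de *: v) (al *: x + be *: y + de *: v)
   = 2 * (al * be * lorentz x y) + de * de.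
  rewrite !lorentzL (proj1 hx) (proj1 hy) vx vy vv.
  by rewrite (lorentzC x v) (lorentzC y v) vx vy (lorentzC y x); ring.
rewrite /hlength; set E := (X in inf X); set m := arccosh _.
have lbE : lbound E m.
  move=> _ [p hp <-]; apply: arccosh_ler; first lra.
  have := proj1 hp; rewrite (dec p) nrm val.
  move: (_ / _ * (_ / _) * _) (lorentz p v) => t d e.
  have d0 : 0 <= d * d by rewrite -expr2 sqr_ge0.
  have tE : t = - (1 + d * d) / 2 by lra.
  rewrite tE -subr_ge0.
  have -> : - (- (1 + d * d) / 2 * (a + a^-1) + d * d) - (a + a^-1) / 2 =
    d * d * ((a + a^-1) - 2) / 2 by field.
  by rewrite divr_ge0 // mulr_ge0 // subr_ge0.
have mE : E m.
  have [k k0 k2] := timelike_scaling w0.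
  exists (k *: x + k *: y + 0 *: v).
    split; first by rewrite nrm k2; ring.
    by rewrite !mxE (proj2 hx) (proj2 hy) mul0r addr0 !mulr1 addr_gt0.
  rewrite /hdist val /m; congr arccosh.
  have -> : k * k * lorentz x y = - 1 / 2 by lra.
  by field.
apply/eqP; rewrite eq_le; apply/andP; split.
  by apply: ge_inf => //; exists m.
by apply: lb_le_inf => //; exists m.
Qed.

Lemma eigenvector g (a : R) : \det (g - a%:M) = 0 -> exists2 z : 'cV[R]_3, z != 0 & g *m z = a *: z.
Proof.
rewrite -det_tr => /eqP/det0P[r r0 h]; exists r^T; first by rewrite trmx_eq0.
apply/eqP; rewrite -subr_eq0 -mul_scalar_mx -mulmxBl; apply/eqP.
by apply: trmx_inj; rewrite trmx_mul trmxK trmx0.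
Qed.

(** As [g] is conjugate to the transpose of its inverse, its characteristic
    polynomial is self-reciprocal up to sign, and has the root [1]. *)
Lemma isometry_charpoly g (a : R) : isometry g -> \det g = 1 ->
  \det (g - a%:M) = (1 - a) * (a * a - (\tr g - 1) * a + 1).
Proof.
move=> gi gd.
pose t := \tr g.
pose m := g 0 0 * g 1 1 - g 0 1 * g 1 0 + (g 0 0 * g 2 2 - g 0 2 * g 2 0)
  + (g 1 1 * g 2 2 - g 1 2 * g 2 1).
have sc (b : R) : b%:M = mx3 b 0 0 0 b 0 0 0 b :> 'M[R]_3.
  by apply/matrixP; elim/ord3_ind; elim/ord3_ind; rewrite !mxE /= ?mulr1n ?mulr0n.
have tE : t = g 0 0 + g 1 1 + g 2 2 by rewrite /t [in LHS](mx3_eta g) mx3_tr.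
have gE : 1 = g 0 0 * (g 1 1 * g 2 2 - g 1 2 * g 2 1)
   - g 0 1 * (g 1 0 * g 2 2 - g 1 2 * g 2 0) + g 0 2 * (g 1 0 * g 2 1 - g 1 1 * g 2 0).
  by rewrite -gd [in LHS](mx3_eta g) mx3_det.
have lin (b d : R) : \det (b *: g - d%:M) = b * b * b - d * (b * b) * m + d * d * b * t - d * d * d.
  have -> : b *: g - d%:M = mx3 (b * g 0 0 - d) (b * g 0 1) (b * g 0 2)
     (b * g 1 0) (b * g 1 1 - d) (b * g 1 2) (b * g 2 0) (b * g 2 1) (b * g 2 2 - d).
    by rewrite sc; apply/matrixP; elim/ord3_ind; elim/ord3_ind; rewrite !mxE ?subr0.
  apply/eqP; rewrite mx3_det tE -subr_eq0; apply/eqP.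
  transitivity (b * b * b * (g 0 0 * (g 1 1 * g 2 2 - g 1 2 * g 2 1)
   - g 0 1 * (g 1 0 * g 2 2 - g 1 2 * g 2 0) + g 0 2 * (g 1 0 * g 2 1 - g 1 1 * g 2 0) - 1)).
    by rewrite /m; ring.
  by rewrite -gE subrr mulr0.
have sym (d : R) : \det (g - d%:M) = \det (1 - d *: g).
  rewrite -[RHS]det_tr -[RHS]mul1r -{1}(_ : \det (lorentz_mx R) * \det (lorentz_mx R) = 1); last first.
    by rewrite -det_mulmx lorentz_mxK det1.
  rewrite -mulrA [_ * \det _]mulrC mulrA -!det_mulmx.
  have -> : lorentz_mx R *m (1 - d *: g)^T *m lorentz_mx R = inv_iso g *m (g - d%:M).
    have [e1 e2] := inv_isoK gi.
    rewrite mulmxBr e1 mul_mx_scalar linearB /= linearZ /= trmx1.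
    rewrite mulmxBr mulmxBl mulmx1 lorentz_mxK -scalemxAr -scalemxAl; congr (_ - _).
  rewrite det_mulmx.
  have [e1 _] := inv_isoK gi; have := congr1 determinant e1.
  by rewrite det_mulmx gd mulr1 det1 => ->; rewrite mul1r.
(* [sym] at [d = 2] is a linear equation between [m] and [t] *)
have mt : m = t.
  have := sym 2; have := lin 1 2; have := lin (-2) (-1).
  rewrite scale1r => + ->.
  have -> : -2 *: g - (-1)%:M = 1 - 2 *: g by rewrite -scalemx1 scaleNr scaleN1r opprK addrC.
  move=> ->; lra.
by have := lin 1 a; rewrite scale1r mt -/t => ->; ring.
Qed.

Lemma ideal_eigenvector g (a : R) z : isometry g -> a * a != 1 -> z != 0 ->
  g *m z = a *: z -> exists2 x, ideal_points x & g *m x = a *: x.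
Proof.
move=> gi a1 z0 gz.
have zz : lorentz z z = 0.
  have := gi z z; rewrite gz !lorentzL mulrA => /eqP.
  rewrite -subr_eq0 -{2}[lorentz z z]mul1r -mulrBl mulf_eq0 subr_eq0 (negbTE a1).
  by move/eqP.
have z00 : z 0 0 != 0.
  apply: contra_neq z0 => e; have := zz; rewrite lorentzE e mul0r oppr0 add0r -!expr2.
  move/eqP; rewrite paddr_eq0 ?sqr_ge0 // !sqrf_eq0 => /andP[/eqP e1 /eqP e2].
  by apply: cV3P; rewrite mxE.
exists ((z 0 0)^-1 *: z).
  by split; [rewrite !lorentzL zz !mulr0|rewrite mxE mulVf].
by rewrite -scalemxAr gz !scalerA mulrC.
Qed.

(** The roots other than [1] of the characteristic polynomial are real, positive
    and distinct, and their eigenvectors are isotropic. *)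
Lemma trace_axis g : isometry g -> \det g = 1 -> 3 < \tr g ->
  exists a x y, has_axis g a x y /\ a <> 1.
Proof.
move=> gi gd t3; pose T := \tr g - 1.
have T2 : 2 < T by rewrite /T; lra.
have D0 : 0 < T * T - 4.
  have -> : T * T - 4 = (T - 2) * (T + 2) by ring.
  by rewrite mulr_gt0 //; lra.
pose q := Num.sqrt (T * T - 4); have q0 : 0 < q by rewrite sqrtr_gt0.
have q2 : q * q = T * T - 4 by rewrite -expr2 sqr_sqrtr // ltW.
pose a := (T + q) / 2; pose b := (T - q) / 2.
have a1 : 1 < a by rewrite /a; lra.
have ab : a * b = 1.
  rewrite (_ : a * b = (T * T - q * q) / 4); last by rewrite /a /b; field.
  by rewrite q2; field.
have a0 : 0 < a by lra.
have bE : b = a^-1 by apply: (mulfI (lt0r_neq0 a0)); rewrite ab divff ?lt0r_neq0.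
have root (d : R) : d * (T - d) = 1 -> \det (g - d%:M) = 0.
  by move=> h; rewrite isometry_charpoly // -/T -h; ring.
have [z z0 gz] : exists2 z : 'cV[R]_3, z != 0 & g *m z = a *: z.
  by apply: eigenvector; apply: root; rewrite -ab /a /b; field.
have [u u0 gu] : exists2 z : 'cV[R]_3, z != 0 & g *m z = b *: z.
  by apply: eigenvector; apply: root; rewrite -ab /a /b; field.
have b1 : b < 1 by rewrite bE invf_lt1.
have b0 : 0 < b by rewrite bE invr_gt0.
have [x hx gx] : exists2 x, ideal_points x & g *m x = a *: x.
  by apply: ideal_eigenvector z0 gz => //; rewrite gt_eqF // -[1]mulr1 ltr_pM.
have [y hy gy] : exists2 x, ideal_points x & g *m x = b *: x.
  by apply: ideal_eigenvector u0 gu => //; rewrite lt_eqF // -[X in _ < X]mulr1 ltr_pM // ltW.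
exists a, x, y; split; last by move=> e; move: a1; rewrite e ltxx.
split=> //; last by rewrite -bE.
move=> e; rewrite e gy in gx; have := congr1 (fun c : 'cV_3 => c 0 0) gx.
by rewrite !mxE (proj2 hy) !mulr1 => ba; move: b1; rewrite ba ltNge ltW.
Qed.

Theorem hyperbolic_trace g : isometry g -> forward g -> \det g = 1 ->
  hyperbolic g <-> 3 < \tr g.
Proof.
move=> gi gf gd; split=> [/(hyperbolic_axis gi gf gd)|/(trace_axis gi gd)].
  move=> [a [x [y [[a0 [hx hy] xy gx gy] a1]]]].
  have [-> _ _] := axis_decomp gi gd a0 hx hy xy gx gy.
  by have := addV_gt2 a0 a1; move: a^-1 => b; lra.
by move=> [a [x [y [ax a1]]]]; apply: axis_hyperbolic ax a1.
Qed.

Theorem hlength_trace g : isometry g -> forward g -> \det g = 1 -> 3 < \tr g ->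
  hlength g = arccosh ((\tr g - 1) / 2).
Proof.
move=> gi gf gd /(trace_axis gi gd)[a [x [y [ax a1]]]].
rewrite (axis_hlength gi gf gd ax); have [a0 [hx hy] xy gx gy] := ax.
have [-> _ _] := axis_decomp gi gd a0 hx hy xy gx gy.
by congr (arccosh (_ / _)); ring.
Qed.
End AxisElements.

(** * The triangle with angles pi/2, pi/10, pi/10 *)
Section Angle.
Variable R : realType.

(** Outside [[-1, 1]] the function [acos] takes the default value [0]. *)
Lemma acos_eq (r t : R) : acos r = t -> t != 0 -> cos t = r.
Proof.
rewrite unlock; case: xgetP => [y -> [_ e] yt _|_ <-]; first by rewrite -yt.
by rewrite eqxx.
Qed.

(** From [cos (3 t) = - cos (2 t)] at [t = pi / 5], after division by
    [cos t + 1]. *)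
Lemma cos_pi5 (d := cos (pi / 5 : R)) : 0 < d /\ 4 * (d * d) = 2 * d + 1.
Proof.
have p0 := pi_gt0 R.
have d0 : 0 < d by apply: cos_gt0_pihalf; apply/andP; split; lra.
split=> //; have c2 : cos (2 * (pi / 5 : R)) = 2 * (d * d) - 1.
  by rewrite mulr_natl cos_mulr2n -/d expr2 mulr_natl.
have c3 : cos (3 * (pi / 5 : R)) = 4 * (d * d * d) - 3 * d.
  have -> : 3 * (pi / 5 : R) = 2 * (pi / 5) + pi / 5 by ring.
  rewrite cosD c2 -/d [in sin _]mulr_natl sin_mulr2n -/d.
  have s2 : sin (pi / 5 : R) * sin (pi / 5) = 1 - d * d.
    by rewrite -!expr2 sin2cos2.
  move: (sin _) s2 => s s2.
  have -> : (2 * (d * d) - 1) * d - (d * s) *+ 2 * s =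
    (2 * (d * d) - 1) * d - 2 * d * (s * s) by ring.
  by rewrite s2; ring.
have e : cos (3 * (pi / 5 : R)) = - cos (2 * (pi / 5 : R)).
  have -> : 3 * (pi / 5 : R) = - (2 * (pi / 5)) + pi by field.
  by rewrite cosDpi cosN.
move: e; rewrite c2 c3 => e.
have d1 : d + 1 != 0 by rewrite lt0r_neq0 // addr_gt0.
apply: (mulfI d1); apply/eqP; rewrite -subr_eq0; apply/eqP.
transitivity (4 * (d * d * d) - 3 * d + (2 * (d * d) - 1)); first by ring.
by rewrite e addNr.
Qed.

Lemma cos_pi10 (c := cos (pi / 10 : R)) :
  exists s, [/\ 0 < c, 0 < s, 2 * (c * c) = 1 + s * s &
    2 * (s * s) * (2 * (s * s)) = 2 * (s * s) + 1].
Proof.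
have p0 := pi_gt0 R.
have c0 : 0 < c by apply: cos_gt0_pihalf; apply/andP; split; lra.
have [d0 d2] := cos_pi5.
exists (Num.sqrt (cos (pi / 5))).
have s2 : Num.sqrt (cos (pi / 5 : R)) * Num.sqrt (cos (pi / 5)) = cos (pi / 5).
  by rewrite -expr2 sqr_sqrtr // ltW.
rewrite s2 sqrtr_gt0; split=> //; last by rewrite -d2; ring.
have -> : pi / 5 = (pi / 10 : R) *+ 2 by rewrite -mulr_natl; field.
by rewrite cos_mulr2n -/c -mulr_natl expr2; ring.
Qed.

End Angle.

Section Frame.
Variable R : realType.
Implicit Types (x y z n : 'cV[R]_3).

Lemma lorentz_hdirection x y z : hplane x ->
  lorentz (hdirection x y) (hdirection x z) = lorentz y z + lorentz x y * lorentz x z.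
Proof.
move=> [xx _]; rewrite /hdirection !lorentzL xx (lorentzC y x); ring.
Qed.

Lemma hangle_cos x y z t : hplane x -> hplane y -> hplane z ->
  hangle x y z = t -> t != 0 ->
  (lorentz y z + lorentz x y * lorentz x z) /
  (Num.sqrt (lorentz x y * lorentz x y - 1) *
           Num.sqrt (lorentz x z * lorentz x z - 1)) = cos t.
Proof.
move=> hx hy hz; rewrite /hangle !lorentz_hdirection // => /acos_eq h /h ->.
by rewrite (proj1 hy) (proj1 hz) -[-1 + _]addrC [-1 + _]addrC.
Qed.

(** Here [x], [y], [z] are the hyperbolic cosines of the sides [BC], [CA], [AB].
    The right angle gives [x = y z], and the two equal angles then give
    [z = y] and [y = cot (pi / 10)]. *)
Lemma triangle_sides (c x y z : R) : 0 < c -> c < 1 -> 1 <= x -> 1 <= y -> 1 <= z ->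
  (y * z - x) / (Num.sqrt (z * z - 1) * Num.sqrt (y * y - 1)) = 0 ->
  (x * z - y) / (Num.sqrt (x * x - 1) * Num.sqrt (z * z - 1)) = c ->
  (x * y - z) / (Num.sqrt (y * y - 1) * Num.sqrt (x * x - 1)) = c ->
  [/\ x = y * y, z = y, 1 < y & y * y * (1 - c * c) = c * c].
Proof.
move=> c0 c1 x1 y1 z1.
have sq (t : R) : 1 <= t -> Num.sqrt (t * t - 1) * Num.sqrt (t * t - 1) = t * t - 1.
  by move=> t1; rewrite -expr2 sqr_sqrtr // subr_ge0 -[1]mulr1 ler_pM.
have := sq _ x1; have := sq _ y1; have := sq _ z1.
move: (Num.sqrt (x * x - 1)) (Num.sqrt (y * y - 1)) (Num.sqrt (z * z - 1)).
move=> X Y Z Z2 Y2 X2 hA hB hC.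
have nz (a b : R) : a / b = c -> b != 0.
  by move=> e; apply: contraTneq c0 => b0; rewrite -e b0 invr0 mulr0 ltxx.
have := nz _ _ hB; have := nz _ _ hC; rewrite !mulf_eq0 !negb_or.
move=> /andP[Y0 X0] /andP[_ Z0].
have xE : x = y * z.
  move/eqP: hA; rewrite mulf_eq0 invr_eq0 mulf_eq0 (negbTE Y0) (negbTE Z0) !orbF.
  by rewrite subr_eq0 => /eqP.
have eB : y * (z * z - 1) = c * (X * Z).
  by rewrite -hB divfK ?mulf_neq0 // xE; ring.
have eC : z * (y * y - 1) = c * (Y * X).
  by rewrite -hC divfK ?mulf_neq0 // xE; ring.
have eB' : y * Z = c * X.
  by apply: (mulIf Z0); rewrite -mulrA Z2 eB; ring.
have eC' : z * Y = c * X.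
  by apply: (mulIf Y0); rewrite -mulrA Y2 eC; ring.
have fB : y * y * (z * z - 1) = c * c * (x * x - 1).
  by rewrite -Z2 -X2; transitivity (y * Z * (y * Z)); [ring|rewrite eB'; ring].
have fC : z * z * (y * y - 1) = c * c * (x * x - 1).
  by rewrite -Y2 -X2; transitivity (z * Y * (z * Y)); [ring|rewrite eC'; ring].
have zy : z = y.
  apply/eqP; rewrite -subr_eq0; have p : z + y != 0 by rewrite lt0r_neq0 //; lra.
  by rewrite -(mulIr_eq0 _ (mulIf p)); apply/eqP; lra.
have y_gt1 : 1 < y.
  rewrite lt_neqAle y1 andbT; apply: contra_neq Y0 => y1'; move/eqP: Y2.
  by rewrite -y1' mulr1 subrr mulf_eq0 orbb => /eqP.
split=> //; first by rewrite xE zy.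
rewrite xE zy in fB.
have ym : y * y - 1 != 0.
  have -> : y * y - 1 = (y - 1) * (y + 1) by ring.
  by rewrite lt0r_neq0 // mulr_gt0; lra.
by apply: (mulIf ym); lra.
Qed.

Lemma isometry_frame (e0 e1 e2 : 'cV[R]_3) :
  lorentz e0 e0 = -1 -> lorentz e1 e1 = 1 -> lorentz e2 e2 = 1 ->
  lorentz e0 e1 = 0 -> lorentz e0 e2 = 0 -> lorentz e1 e2 = 0 ->
  exists2 F : 'M[R]_3, isometry F &
    forall a b d, F *m (\col_i nth 0 [:: a; b; d] i) = a *: e0 + b *: e1 + d *: e2.
Proof.
move=> h00 h11 h22 h01 h02 h12.
pose F : 'M[R]_3 := mx3 (e0 0 0) (e1 0 0) (e2 0 0) (e0 1 0) (e1 1 0) (e2 1 0)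
                        (e0 2 0) (e1 2 0) (e2 2 0).
have Fe a b d : F *m (\col_i nth 0 [:: a; b; d] i) = a *: e0 + b *: e1 + d *: e2.
  by apply: cV3P; rewrite !mxE big_ord3 !mxE /=; ring.
exists F => // x y.
have xE z : z = \col_i nth 0 [:: z 0 0; z 1 0; z 2 0] i :> 'cV[R]_3.
  by apply: cV3P; rewrite mxE.
rewrite {1}(xE x) {1}(xE y) !Fe !lorentzL.
rewrite (lorentzC e1 e0) (lorentzC e2 e0) (lorentzC e2 e1).
by rewrite h00 h11 h22 h01 h02 h12 lorentzE; ring.
Qed.

Definition vec3 (a b d : R) : 'cV[R]_3 := \col_i nth 0 [:: a; b; d] i.

(** The frame consists of [A] and of the normals of the sides [AB] and [CA],
    which are orthogonal because the angle at [A] is right. *)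
Lemma triangle_frame (c s : R) (A B C : 'cV[R]_3) :
  0 < c -> 0 < s -> 2 * (c * c) = 1 + s * s -> c < 1 ->
  cos (pi / 10) = c ->
  hplane A -> hplane B -> hplane C ->
  hangle A B C = pi / 2 -> hangle B C A = pi / 10 -> hangle C A B = pi / 10 ->
  exists F (y t : R), [/\ isometry F, 0 < y /\ 0 < t, s * y = c * t &
    [/\ A = F *m vec3 1 0 0, B = F *m vec3 y 0 (- t) & C = F *m vec3 y (- t) 0]].
Proof.
move=> c0 s0 s2 c1 cE hA hB hC aA aB aC; have p0 := pi_gt0 R.
have eA := hangle_cos hA hB hC aA (lt0r_neq0 (_ : 0 < pi / 2)).
have eB := hangle_cos hB hC hA aB (lt0r_neq0 (_ : 0 < pi / 10)).
have eC := hangle_cos hC hA hB aC (lt0r_neq0 (_ : 0 < pi / 10)).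
have {}eA := eA (ltac:(lra)); have {}eB := eB (ltac:(lra)); have {}eC := eC (ltac:(lra)).
rewrite cos_pihalf in eA; rewrite cE in eB eC.
have lAB := hplane_lorentz hA hB; have lBC := hplane_lorentz hB hC.
have lCA := hplane_lorentz hC hA.
rewrite (lorentzC A C) in eA; rewrite (lorentzC B A) in eB; rewrite (lorentzC C B) in eC.
pose x := - lorentz B C; pose y := - lorentz C A; pose z := - lorentz A B.
have [xE zE y1 yc] : [/\ x = y * y, z = y, 1 < y & y * y * (1 - c * c) = c * c].
  apply: triangle_sides; rewrite ?/x ?/y ?/z ?mulrNN //; first lra.
  - lra.
  - lra.
  - by rewrite -[RHS]eA; congr (_ / _); ring.
  - by rewrite -[RHS]eB; congr (_ / _); ring.
  - by rewrite -[RHS]eC; congr (_ / _); ring.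
have AB : lorentz A B = - y by rewrite -zE /z opprK.
have CA : lorentz A C = - y by rewrite lorentzC /y opprK.
have BC : lorentz B C = - (y * y) by rewrite -xE /x opprK.
pose t := Num.sqrt (y * y - 1).
have yy : 0 < y * y - 1.
  have -> : y * y - 1 = (y - 1) * (y + 1) by ring.
  by rewrite mulr_gt0; lra.
have t0 : 0 < t by rewrite sqrtr_gt0.
have t2 : t * t = y * y - 1 by rewrite -expr2 sqr_sqrtr // ltW.
have sy : s * y = c * t.
  have h : (s * y) ^+ 2 = (c * t) ^+ 2.
    have -> : (c * t) ^+ 2 = c * c * (t * t) by ring.
    have -> : (s * y) ^+ 2 = s * s * (y * y) by ring.
    rewrite t2 (_ : s * s = 2 * (c * c) - 1); last by rewrite s2; ring.
    have -> : (2 * (c * c) - 1) * (y * y) = c * c * (y * y) - y * y * (1 - c * c) by ring.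
    by rewrite yc; ring.
  move/eqP: h; rewrite eqrXn2 // ?mulr_ge0 //; try exact: ltW; last lra.
  by move/eqP.
have tn0 : t != 0 by rewrite lt0r_neq0.
pose e1 := (- t^-1) *: (C + (- y) *: A); pose e2 := (- t^-1) *: (B + (- y) *: A).
have [AA _] := hA; have [BB _] := hB; have [CC _] := hC.
have [] := @isometry_frame A e1 e2; rewrite ?/e1 ?/e2 //.
- rewrite !lorentzL (lorentzC C A) CC AA CA.
  by transitivity ((y * y - 1) / (t * t)); [field|rewrite -t2 divff // mulf_neq0].
- rewrite !lorentzL (lorentzC B A) BB AA AB.
  by transitivity ((y * y - 1) / (t * t)); [field|rewrite -t2 divff // mulf_neq0].
- by rewrite !lorentzL AA CA; ring.
- by rewrite !lorentzL AA AB; ring.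
- by rewrite !lorentzL AA AB (lorentzC C B) (lorentzC C A) BC CA; ring.
move=> F Fi Fe; exists F, y, t; split=> //; first by split=> //; lra.
rewrite /vec3 !Fe !scale0r !addr0 scale1r.
have k (Z : 'cV[R]_3) : - t *: ((- t^-1) *: (Z + (- y) *: A)) = Z - y *: A.
  by rewrite scalerA mulrNN divff // scale1r scaleNr.
by rewrite !k; split=> //; rewrite addrC subrK.
Qed.
End Frame.

(** * The triangle group *)
Section ConjClass.
Variable R : realType.
Variable G : set 'M[R]_3.
Hypothesis G1 : G 1.
Hypothesis GM : forall g h, G g -> G h -> G (g * h).
Hypothesis GV : forall g, G g -> G g^-1.
Hypothesis Gu : forall g, G g -> g \is a GRing.unit.

Lemma conj_class_refl g : conj_class G g g.
Proof. by exists 1 => //; rewrite mul1r invr1 mulr1. Qed.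

Lemma conj_class_sub g h : G h -> (conj_class G (h * g * h^-1) `<=` conj_class G g)%classic.
Proof.
move=> Gh _ [k Gk <-]; exists (k * h); first exact: GM.
by rewrite invrM ?Gu // !mulrA.
Qed.

Lemma conj_class_eq g h : G h -> conj_class G (h * g * h^-1) = conj_class G g.
Proof.
move=> Gh; apply/seteqP; split; first exact: conj_class_sub.
have e : g = h^-1 * (h * g * h^-1) * (h^-1)^-1.
  by rewrite invrK !mulrA mulVr ?Gu // mul1r -mulrA mulVr ?Gu // mulr1.
by rewrite [X in (conj_class G X `<=` _)%classic]e; apply/conj_class_sub/GV.
Qed.
End ConjClass.

Section TriangleGroup.
Variables (R : realType) (c s y t : R) (F : 'M[R]_3) (A B C : 'cV[R]_3).
Hypothesis c0 : 0 < c.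
Hypothesis s0 : 0 < s.
Hypothesis s2 : 2 * (c * c) = 1 + s * s.
Hypothesis phi2 : 2 * (s * s) * (2 * (s * s)) = 2 * (s * s) + 1.
Hypothesis Fi : isometry F.
Hypothesis y0 : 0 < y.
Hypothesis t0 : 0 < t.
Hypothesis sy : s * y = c * t.
Hypothesis AE : A = F *m vec3 1 0 0.
Hypothesis BE : B = F *m vec3 y 0 (- t).
Hypothesis CE : C = F *m vec3 y (- t) 0.
Hypothesis hA : hplane A.
Hypothesis hB : hplane B.
Hypothesis hC : hplane C.

Definition frame_conj (M : 'M[R]_3) := F * M * F^-1.

Let Fu : F \is a GRing.unit := isometry_unit Fi.

Lemma frame_conjM M N : frame_conj (M * N) = frame_conj M * frame_conj N.
Proof. by rewrite /frame_conj !mulrA -[_ * F^-1 * F]mulrA mulVr // mulr1. Qed.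
Lemma frame_conj1 : frame_conj 1 = 1.
Proof. by rewrite /frame_conj mulr1 divrr. Qed.
Lemma frame_conj_inj : injective frame_conj.
Proof.
move=> M N /(congr1 (fun X => F^-1 * X * F)).
by rewrite /frame_conj !mulrA mulVr // !mul1r -!mulrA mulVr // !mulr1.
Qed.
Lemma frame_conj_det M : \det (frame_conj M) = \det M.
Proof.
rewrite /frame_conj !det_mulmx mulrAC -det_mulmx.
by rewrite [F *m _](divrr Fu) det1 mul1r.
Qed.
Lemma frame_conj_tr M : \tr (frame_conj M) = \tr M.
Proof. by rewrite /frame_conj mxtrace_mulC [F^-1 *m _]mulrA mulVr // mul1r. Qed.

Lemma hrefl_vec3 a b d : hrefl (F *m vec3 a b d) = frame_conj
  (mx3 (1 + 2 * (a * a)) (- (2 * (a * b))) (- (2 * (a * d)))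
      (2 * (a * b)) (1 - 2 * (b * b)) (- (2 * (b * d)))
      (2 * (a * d)) (- (2 * (b * d))) (1 - 2 * (d * d))).
Proof. by rewrite hrefl_conj // hrefl_mx3 /vec3 !mxE. Qed.

Lemma lorentz_vec3 a b d a' b' d' :
  lorentz (F *m vec3 a b d) (F *m vec3 a' b' d') = - (a * a') + b * b' + d * d'.
Proof. by rewrite Fi lorentzE !mxE. Qed.

Let normal1 := F *m vec3 0 1 0.
Let normal2 := F *m vec3 0 0 1.
Let normal3 := F *m vec3 s (- c) (- c).

Lemma hrefl_normals : [/\ hrefl normal1 = frame_conj (refl1 R),
  hrefl normal2 = frame_conj (refl2 R) & hrefl normal3 = frame_conj (refl3 c s)].
Proof.
by split; rewrite hrefl_vec3; congr frame_conj; congr mx3; ring.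
Qed.

Lemma side_reflections_normals :
  [/\ side_reflections A B C (frame_conj (refl1 R)),
      side_reflections A B C (frame_conj (refl2 R)) &
      side_reflections A B C (frame_conj (refl3 c s))].
Proof.
have [<- <- <-] := hrefl_normals; split.
- exists normal1 => //; split; first by rewrite lorentz_vec3; ring.
  by apply: Or31; split; split=> //; rewrite ?AE ?BE lorentz_vec3; ring.
- exists normal2 => //; split; first by rewrite lorentz_vec3; ring.
  by apply: Or33; split; split=> //; rewrite ?AE ?CE lorentz_vec3; ring.
- exists normal3 => //; split; first by rewrite lorentz_vec3; have := s2; lra.
  by apply: Or32; split; split=> //; rewrite ?BE ?CE lorentz_vec3; have := sy; lra.
Qed.

(** The orthogonality conditions determine the normal up to sign, and the
    reflection only depends on products of two coordinates of the normal. *)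
Lemma side_reflectionsP g : side_reflections A B C g ->
  [\/ g = frame_conj (refl1 R), g = frame_conj (refl2 R)
    | g = frame_conj (refl3 c s)].
Proof.
have tn0 : t != 0 by rewrite lt0r_neq0.
have sn0 : s != 0 by rewrite lt0r_neq0.
move=> [n [n1 lines] <-].
have [a [b [d nE]]] : exists a b d, n = F *m vec3 a b d.
  exists ((invmx F *m n) 0 0), ((invmx F *m n) 1 0), ((invmx F *m n) 2 0).
  have -> : vec3 ((invmx F *m n) 0 0) ((invmx F *m n) 1 0) ((invmx F *m n) 2 0) = invmx F *m n.
    by apply: cV3P; rewrite !mxE.
  by rewrite mulmxA mulmxV // mul1mx.
move: n1 lines; rewrite {}nE hrefl_vec3 lorentz_vec3 => n1 lines.
have lA : lorentz A (F *m vec3 a b d) = - a by rewrite AE lorentz_vec3; ring.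
have lB : lorentz B (F *m vec3 a b d) = - (y * a) - t * d.
  by rewrite BE lorentz_vec3; ring.
have lC : lorentz C (F *m vec3 a b d) = - (y * a) - t * b.
  by rewrite CE lorentz_vec3; ring.
case: lines => -[[_ h1] [_ h2]].
- apply: Or31; rewrite lA lB in h1 h2.
  have a0 : a = 0 by lra.
  have d0 : d = 0 by apply: (mulfI tn0); rewrite a0 in h2; lra.
  have bb : b * b = 1 by rewrite a0 d0 in n1; lra.
  by rewrite a0 d0 bb; congr frame_conj; congr mx3; ring.
- apply: Or33; rewrite lB lC in h1 h2.
  have key u : - (y * a) - t * u = 0 -> s * u = - (c * a).
    move=> e; apply: (mulfI tn0).
    have -> : t * (s * u) = s * (t * u) by ring.
    have -> : t * u = - (y * a) by lra.
    by transitivity (- (s * y * a)); [ring|rewrite sy; ring].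
  have sb := key _ h2; have sd := key _ h1.
  have aa : a * a = s * s.
    have e : s * s * (- (a * a) + b * b + d * d) = s * s by rewrite n1 mulr1.
    have {}e : - (s * s * (a * a)) + s * b * (s * b) + s * d * (s * d) = s * s.
      by rewrite -[RHS]e; ring.
    rewrite sb sd in e; rewrite -[RHS]e.
    have -> : - (s * s * (a * a)) + - (c * a) * - (c * a) + - (c * a) * - (c * a) =
      (2 * (c * c) - s * s) * (a * a) by ring.
    by rewrite s2; ring.
  have ss : s * s != 0 by rewrite mulf_neq0.
  have ab u : s * u = - (c * a) -> a * u = - (s * c).
    move=> e; apply: (mulfI sn0).
    transitivity (a * (s * u)); first by ring.
    by rewrite e; transitivity (- (c * (a * a))); [ring|rewrite aa; ring].
  have uu u v : s * u = - (c * a) -> s * v = - (c * a) -> u * v = c * c.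
    move=> e1 e2; apply: (mulfI ss).
    transitivity (s * u * (s * v)); first by ring.
    by rewrite e1 e2; transitivity (c * c * (a * a)); [ring|rewrite aa; ring].
  rewrite (ab _ sb) (ab _ sd) (uu _ _ sb sb) (uu _ _ sb sd) (uu _ _ sd sd) aa.
  by congr frame_conj; congr mx3; ring.
- apply: Or32; rewrite lA lC in h1 h2.
  have a0 : a = 0 by lra.
  have b0 : b = 0 by apply: (mulfI tn0); rewrite a0 in h1; lra.
  have dd : d * d = 1 by rewrite a0 b0 in n1; lra.
  by rewrite a0 b0 dd; congr frame_conj; congr mx3; ring.
Qed.

Let rotword := rotword c s.

Lemma isometry_inv_forward (g : 'M[R]_3) : isometry g -> forward g -> forward (invmx g).
Proof.
move=> gi gf x hx; have ii := isometry_invmx gi; have u := isometry_unit gi.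
have := ii x x; rewrite (proj1 hx) => /hplane_sign[//|hN].
have := gf _ hN; rewrite mulmxN mulmxA mulmxV // mul1mx => -[_].
by rewrite mxE; have := proj2 hx; lra.
Qed.

Lemma side_reflections_isometry g : side_reflections A B C g ->
  isometry g /\ forward g.
Proof.
by move=> [n [n1 _] <-]; split; [exact: hrefl_isometry|exact: hrefl_forward].
Qed.

Lemma generated_isometry g : generated (side_reflections A B C) g ->
  isometry g /\ forward g.
Proof.
elim=> {g} [g /side_reflections_isometry //|||].
- by split=> [|x]; [exact: isometry_1|rewrite mul1mx].
- move=> g h _ [gi gf] _ [hi hf]; split; first exact: isometry_mul.
  by move=> x hx; rewrite -mulmxA; apply/gf/hf.
- by move=> g _ [gi gf]; split; [exact: isometry_invmx|exact: isometry_inv_forward].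
Qed.

Lemma generated_rotword g : generated (side_reflections A B C) g ->
  exists2 M, rotword M & g = frame_conj M \/ g = frame_conj (refl1 R * M).
Proof.
have [gi gp gV] := rotword_gen c s.
elim=> {g} [g /side_reflectionsP[]->|||].
- by exists 1; [exact: rotword_1|right; rewrite mulr1].
- exists (rot_i R) => //; right; congr frame_conj.
  by rewrite -refl12 mulrA refl1K mul1r.
- exists (rot_p c s) => //; right; congr frame_conj.
  by rewrite -(refl13 s2) mulrA refl1K mul1r.
- by exists 1; [exact: rotword_1|left; rewrite frame_conj1].
- move=> g h _ [M hM gE] _ [N hN hE].
  have hM' := rotword_refl1 s2 hM.
  case: gE => ->; case: hE => ->; rewrite -frame_conjM.
  + by exists (M * N); [exact: rotword_mul|left].
  + exists (refl1 R * M * refl1 R * N); first exact: rotword_mul.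
    by right; rewrite !mulrA refl1K mul1r.
  + by exists (M * N); [exact: rotword_mul|right; rewrite mulrA].
  + exists (refl1 R * M * refl1 R * N); first exact: rotword_mul.
    by left; rewrite !mulrA.
- move=> g _ [M hM gE]; have [N [hN MN NM]] := rotword_inv s2 hM.
  have r1 := refl1K R.
  have inv (g' h' : 'M[R]_3) : g' * h' = 1 -> h' * g' = 1 -> g'^-1 = h'.
    move=> e1 e2; have u : g' \is a GRing.unit by apply/unitrP; exists h'.
    by apply: (mulrI u); rewrite divrr.
  case: gE => ->.
    exists N => //; left; apply: inv; rewrite -frame_conjM ?MN ?NM frame_conj1 //.
  exists (refl1 R * N * refl1 R); first exact: rotword_refl1.
  right; apply: inv; rewrite -frame_conjM -[RHS]frame_conj1; congr frame_conj.
    rewrite !mulrA -[refl1 R * M * refl1 R * refl1 R]mulrA r1 mulr1.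
    by rewrite -[_ * M * N]mulrA MN mulr1.
  rewrite !mulrA r1 mul1r -[N * refl1 R * refl1 R]mulrA r1 mulr1.
  by rewrite NM.
Qed.

(** Rotation words have determinant [1], so the positive determinant excludes
    the words preceded by [refl1]. *)
Lemma triangle_groupP g : triangle_group A B C g ->
  [/\ isometry g, forward g, \det g = 1 & exists2 M, rotword M & g = frame_conj M].
Proof.
move=> [gg gd]; have [gi gf] := generated_isometry gg.
have [M hM gE] := generated_rotword gg.
have {}gE : g = frame_conj M.
  case: gE => // gE; have [d1 _ _] := refl_det s2.
  by move: gd; rewrite gE frame_conj_det det_mulmx d1 (rotword_det s2 hM) mulr1 ltr0N1.
split=> //; last by exists M.
by rewrite gE frame_conj_det (rotword_det s2 hM).
Qed.

Lemma rotword_triangle_group M : rotword M -> triangle_group A B C (frame_conj M).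
Proof.
have [r1 r2 r3] := side_reflections_normals.
move=> hM; split; last by rewrite frame_conj_det (rotword_det s2 hM).
elim: hM => {M} [|M _ IH|M _ IH|M _ IH].
- by rewrite frame_conj1; exact: generated_1.
- rewrite -refl12 !frame_conjM.
  by apply: generated_M IH; apply: generated_M; apply: generated_in.
- rewrite -(refl13 s2) !frame_conjM.
  by apply: generated_M IH; apply: generated_M; apply: generated_in.
- rewrite -(refl31 s2) !frame_conjM.
  by apply: generated_M IH; apply: generated_M; apply: generated_in.
Qed.

End TriangleGroup.

(** * The length spectrum *)

(** The indices whose entry is below [l3] are [k1] and [k2]; by monotonicity they
    form an initial segment. *)
Lemma spectrum_first_three (R : realType) (lam : nat -> R) (k1 k2 k3 : nat) (l1 l3 : R) :
  (forall j k : nat, (0 < j)%N -> (j <= k)%N -> lam j <= lam k) ->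
  (0 < k1)%N -> (0 < k2)%N -> (0 < k3)%N -> k1 <> k2 ->
  lam k1 = l1 -> lam k2 = l1 -> lam k3 = l3 -> l1 < l3 ->
  (forall k, (0 < k)%N -> lam k < l3 -> k = k1 \/ k = k2) ->
  [/\ lam 1%N = lam 2%N, lam 2%N = l1, lam 2%N < lam 3%N & lam 3%N = l3].
Proof.
move=> mono p1 p2 p3 n12 e1 e2 e3 l13 low.
wlog lt12 : k1 k2 p1 p2 n12 e1 e2 low / (k1 < k2)%N.
  move=> W; case: (ltngtP k1 k2) => [h|h|//].
    exact: (W k1 k2).
  by apply: (W k2 k1) => // [/esym//|k kp kl]; case: (low k kp kl); [right|left].
have below k : (0 < k)%N -> (k <= k2)%N -> k = k1 \/ k = k2.
  by move=> kp kk; apply: low => //; apply: le_lt_trans (mono _ _ kp kk) _; rewrite e2.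
have k21 : k2 = 2.
  have h1 := below 1%N isT (ltac:(lia)); have h2 := below 2%N isT (ltac:(lia)).
  lia.
have k11 : k1 = 1%N by have h1 := below 1%N isT (ltac:(lia)); lia.
subst k1 k2.
have l3le : l3 <= lam 3%N.
  by rewrite leNgt; apply/negP => h; have [|] := low 3%N isT h.
have k33 : (3 <= k3)%N.
  have n1 : k3 <> 1%N by move=> h; move: l13; rewrite -e3 h e1 ltxx.
  have n2 : k3 <> 2%N by move=> h; move: l13; rewrite -e3 h e2 ltxx.
  lia.
have e33 : lam 3%N = l3.
  by apply/eqP; rewrite eq_le l3le andbT -e3; apply: mono.
by rewrite e1 e2 e33.
Qed.

Theorem mainTheorem5 (R : realType) (A B C : 'cV[R]_3) (lam : nat -> R)
    (triABC : htriangle A B C)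
    (angleA : hangle A B C = pi / 2)
    (angleB : hangle B C A = pi / 10)
    (angleC : hangle C A B = pi / 10)
    (lamP : is_length_spectrum (triangle_group A B C) lam) :
  [/\ lam 1%N = lam 2%N,
      lam 2%N = 2 * arccosh (2 * cos (pi / 10) ^+ 2),
      lam 2%N < lam 3%N &
      lam 3%N = 2 * arccosh (cos (pi / 10) * (4 * cos (pi / 10) ^+ 2 - 1))].
Proof.
have [s [c0 s0 s2 phi2]] := cos_pi10 R.
move: (erefl (cos (pi / 10 : R))) c0 s2; move: {2 3 4 5 6 7}(cos (pi / 10)) => c cE c0 s2.
rewrite !cE.
have p0 := phi_gt0 s0.
have lb := gold_lb phi2 p0.
(* [c = 1] would make [2 s^2 = 2], which is not a root of [X^2 = X + 1] *)
have c1 : c < 1.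
  have cle := cos_le1 (pi / 10 : R); rewrite cE in cle.
  rewrite lt_neqAle cle andbT; apply/eqP => c1.
  by move: phi2; rewrite (_ : s * s = 1); [lra|move: s2; rewrite c1; lra].
have [hA hB hC _] := triABC.
have [F [y [t [Fi [y0 t0] sy [AE BE CE]]]]] :=
  triangle_frame c0 s0 s2 c1 cE hA hB hC angleA angleB angleC.
pose G := triangle_group A B C.
have GP g : G g -> [/\ isometry g, forward g, \det g = 1 &
    exists2 M, rotword c s M & g = frame_conj F M].
  exact: (triangle_groupP s0 s2 Fi t0 sy AE BE CE).
have GW M : rotword c s M -> G (frame_conj F M).
  exact: (rotword_triangle_group s2 Fi sy AE BE CE hA hB hC).
have G1 : G 1 by rewrite -(frame_conj1 Fi); apply/GW/rotword_1.
have Gu g : G g -> g \is a GRing.unit by case/GP => gi _ _ _; exact: isometry_unit.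
have GM g h : G g -> G h -> G (g * h).
  move=> /GP[_ _ _ [M hM ->]] /GP[_ _ _ [N hN ->]].
  by rewrite -frame_conjM //; apply: GW; apply: rotword_mul.
have GV g : G g -> G g^-1.
  by move=> [gg gd]; split; [exact: generated_V|rewrite [\det _]det_inv invr_gt0].
have hypP g : G g -> hyperbolic g <-> 3 < \tr g.
  by case/GP => gi gf gd _; exact: hyperbolic_trace.
have lenP g : G g -> 3 < \tr g -> hlength g = arccosh ((\tr g - 1) / 2).
  by case/GP => gi gf gd _; exact: hlength_trace.
move: lamP => [mono [cl [[clT clI clS] lamE]]].
have classP k : (0 < k)%N -> exists g, [/\ G g, 3 < \tr g, cl k = conj_class G g &
    lam k = arccosh ((\tr g - 1) / 2)].
  move=> kp; have [g [Gg gh] gE] := clT _ kp.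
  have g3 := (hypP _ Gg).1 gh; exists g; split=> //.
  by rewrite -lenP //; apply: (lamE k) => //; rewrite -gE; exact: conj_class_refl.
have ex M (hM : rotword c s M) : 3 < \tr M -> exists k, [/\ (0 < k)%N,
    cl k = conj_class G (frame_conj F M) & lam k = arccosh ((\tr M - 1) / 2)].
  move=> t3; have t3' : 3 < \tr (frame_conj F M) by rewrite frame_conj_tr.
  have GM' := GW _ hM.
  have [k kp kE] : exists2 k, (0 < k)%N & cl k = conj_class G (frame_conj F M).
    have [|k kp kE] := clS (conj_class G (frame_conj F M)).
      by exists (frame_conj F M) => //; split=> //; apply/hypP.
    by exists k.
  exists k; split=> //; rewrite -(frame_conj_tr Fi M) -lenP //.
  by apply: (lamE k) => //; rewrite kE; exact: conj_class_refl.
pose phi := 2 * (s * s).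
have [t1 t2 t3] := And3 (tr_short s2 phi2) (tr_short_bar s2 phi2) (tr_long s2 phi2).
have [k1 [p1 K1 L1]] := ex _ (rotword_short s2 phi2) (ltac:(rewrite t1; lra)).
have [k2 [p2 K2 L2]] := ex _ (rotword_short_bar s2 phi2) (ltac:(rewrite t2; lra)).
have [k3 [p3 K3 L3]] := ex _ (rotword_long s2 phi2) (ltac:(rewrite t3; lra)).
rewrite t1 in L1; rewrite t2 in L2; rewrite t3 in L3.
have cc : 4 * (c * c) = phi + 2 by rewrite /phi; lra.
(* [cosh l = 2 cosh^2 (l / 2) - 1], and [(tr g - 1) / 2 = cosh l] *)
have V1 : 2 * arccosh (2 * c ^+ 2) = arccosh ((4 + 5 * phi - 1) / 2).
  rewrite -arccosh_double; last by rewrite expr2; lra.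
  congr arccosh; rewrite (_ : 2 * c ^+ 2 = (phi + 2) / 2); last by rewrite -cc expr2; field.
  have e : phi ^+ 2 = phi + 1 by rewrite expr2.
  rewrite (_ : 2 * ((phi + 2) / 2) ^+ 2 - 1 = (phi ^+ 2 + 4 * phi + 4) / 2 - 1);
    last by field.
  by rewrite e; field.
have V3 : 2 * arccosh (c * (4 * c ^+ 2 - 1)) = arccosh ((6 + 11 * phi - 1) / 2).
  rewrite (_ : 4 * c ^+ 2 - 1 = phi + 1); last by rewrite expr2 cc; ring.
  rewrite -arccosh_double; last first.
    have c12 : 1 / 2 <= c by apply: ltW; apply: sqr_gtl; lra.
    have : 1 / 2 * (phi + 1) <= c * (phi + 1) by rewrite ler_wpM2r // /phi; lra.
    by move: (c * _) => z; rewrite /phi; lra.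
  congr arccosh.
  have e : phi * phi = phi + 1 by [].
  have -> : 2 * (c * (phi + 1)) ^+ 2 = 4 * (c * c) * (phi * phi + 2 * phi + 1) / 2 by field.
  rewrite cc e.
  have -> : (phi + 2) * (phi + 1 + 2 * phi + 1) = 3 * (phi * phi) + 8 * phi + 4 by ring.
  by rewrite e; field.
rewrite V1 V3.
apply: (spectrum_first_three mono p1 p2 p3 _ L1 L2 L3).
- move=> k12; have : conj_class G (frame_conj F (qrot c s qshort))
      (frame_conj F (qrot c s (qbar qshort))).
    by rewrite -K1 k12 K2; exact: conj_class_refl.
  move=> [h /[dup] /Gu hu /GP[_ _ _ [K hK hE]] e].
  apply: (qrot_short_nconj c0 s0 s2 phi2 hK).
  apply: (frame_conj_inj Fi); rewrite !frame_conjM // -hE -e.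
  by rewrite mulrVK.
- by apply: arccosh_ltr; rewrite /phi; lra.
move=> k kp kl; have [g [Gg g3 kE lE]] := classP _ kp.
have [gi gf gd [M hM gE]] := GP _ Gg.
have tg : \tr g < 6 + 11 * phi.
  rewrite ltNge; apply/negP => h; move: kl; apply/negP; rewrite -leNgt lE.
  by apply: arccosh_ler; rewrite /phi in h *; lra.
rewrite gE frame_conj_tr // in g3 tg.
have [K hK hE] := rotword_short_class s0 s2 phi2 hM g3 tg.
have GK := GW _ hK.
have cls N : K * M = N * K -> cl k = conj_class G (frame_conj F N).
  move=> e; rewrite kE -(conj_class_eq GM GV Gu g GK) gE; congr conj_class.
  by rewrite -frame_conjM // e frame_conjM // mulrK // Gu.
by case: hE => /cls e; [left|right]; apply: clI; rewrite ?inE //= e.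
Qed.
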